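(* Assume that for each route $l=1,\dots,L$: $E X^{(l)}_1<\infty$, $X^{(l)}_1$ is non-lattice and strictly positive, $E[(V^{(l)}_1)^q]<\infty$ for every $q>0$, and the CDF $F_l$ of $V^{(l)}_1$ is continuous. Assume $$\sum_{l=1}^L \frac{E V_1^{(l)}}{E X_1^{(l)}}P_l(j)<C_j\quad\text{for each } j=1,\dots,J,$$ and that station $j$ of the $s$-th system has $C_j^s=sC_j$ servers. Then for every $\delta>0$, $E_\pi^s|\tau'|=o(s^\delta)$ as $s\to\infty$.
   Context: A network has $J$ stations, station $j$ having $C_j$ servers (base system), and $L$ routes; route $l$ has a routing vector $P_l\in\{0,1\}^J$, where $P_l(j)=1$ means a route-$l$ job requires one server at station $j$, simultaneously at all such stations and for its whole service time. For each $l$, route-$l$ requests arrive according to a renewal process with i.i.d. interarrival times $X^{(l)}_n$ (CDF $G_l$, finite mean) and have i.i.d. service times $V^{(l)}_n$ (CDF $F_l$, finite mean), independent of arrivals; the $L$ streams are mutually independent. In the $s$-th system interarrival times are $X^{(l)}_n/s$ (service times unscaled) and station $j$ has $C_j^s$ servers. Consider the coupled network of infinite-server stations fed by the same stationary streams (no job ever blocked), in stationarity on $\mathbb R$. Let $Q_j(t,0)$ be the number of jobs at station $j$ at time $t$ and $R(t)$ the maximum remaining service time over all jobs in the network at time $t$ ($0$ if none). Define $$\tau'=\sup\{t<0:\ R(t)\le|t| \text{ and } Q_j(u,0)\le C_j^s \text{ for all } j \text{ and all } u\in[t,t+R(t)]\}.$$ $E_\pi^s$ denotes expectation for the stationary $s$-th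 system. *)

(* Defs.v *)
From HB Require Import structures.
From mathcomp Require Import all_boot all_order all_algebra.
From mathcomp Require Import all_classical all_reals all_analysis.
Set Implicit Arguments. Unset Strict Implicit. Unset Printing Implicit Defensive.
Import Order.TTheory GRing.Theory Num.Theory.
Local Open Scope classical_set_scope.
Local Open Scope ring_scope.

Section generic_probability.
Context {d : measure_display} {Omega : measurableType d} {R : realType}.
Local Open Scope ereal_scope.

Definition rv_events (X : Omega -> R) : set_system Omega :=
  [set A | exists2 B : set R, measurable B & A = X @^-1` B].

Definition rv2_events (X Y : Omega -> R) : set_system Omega :=
  [set A | exists2 B : set (R * R)%type, measurable B &
           A = (fun w => (X w, Y w)) @^-1` B].

Definition mutual_indep (P : probability Omega R) (I : eqType) (D : set I)
  (F : I -> set_system Omega) : Prop :=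
  forall (J : seq I) (A : I -> set Omega), uniq J ->
    (forall i, i \in J -> D i /\ F i (A i)) ->
    P (\big[setI/setT]_(i <- J) A i) = (\prod_(i <- J) fine (P (A i)))%:E.

Definition same_law (P : probability Omega R) (X Y : Omega -> R) : Prop :=
  forall B : set R, measurable B -> P (X @^-1` B) = P (Y @^-1` B).

End generic_probability.

Section network.
Context {d : measure_display} {Omega : measurableType d} {R : realType}.
Variables (J L : nat) (Pm : 'I_L -> 'I_J -> bool).
Local Open Scope ereal_scope.

(* index set of the primitive random elements of one system:
   inl (inl l)       : the pair (-T l 0, T l 1) straddling time 0 on route l
   inl (inr (l, n))  : the interarrival time T l (n+1) - T l n on route l (n <> 0)
   inr (l, n)        : the service time of the n-th route-l job            *)
Definition idx := (('I_L + ('I_L * int)) + ('I_L * int))%type.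

Definition gap (T : 'I_L -> int -> Omega -> R) l (n : int) w : R :=
  (T l (n + 1)%R w - T l n w)%R.

(* (T, V) is the s-th system's stationary input on R: for each route l the
   arrival times (T l n)_{n in Z} form a stationary renewal process with
   interarrival law X0 l / s (indexed so that T l 0 <= 0 < T l 1), the
   service times V l n are i.i.d. with the law of V0 l, and everything is
   independent. *)
Definition stationary_input (P : probability Omega R) (X0 V0 : 'I_L -> Omega -> R)
  (s : nat) (T V : 'I_L -> int -> Omega -> R) : Prop :=
  [/\ (forall l n, measurable_fun setT (T l n)) /\
      (forall l n, measurable_fun setT (V l n)),
      (forall l w, (T l 0%R w <= 0)%R /\ (0 < T l 1%R w)%R),
      (forall l (n : int), n != 0%R -> same_law P (gap T l n) (fun w => X0 l w / s%:R)%R) /\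
      (forall l n, same_law P (V l n) (V0 l)),
      (* joint law of backward/forward recurrence times at 0 of the
         stationary renewal process with mean interarrival E[X0]/s:
         P(-T0 > a, T1 > b) = (s / E X0) int_{a+b}^oo P(X0/s > x) dx *)
      (forall l (a b : R), (0 <= a)%R -> (0 <= b)%R ->
         P [set w | (a < - T l 0%R w)%R /\ (b < T l 1%R w)%R] * 'E_P[X0 l] =
         (s%:R)%:E * \int[lebesgue_measure]_(x in `[(a + b)%R, +oo[%classic)
                         P [set w | (s%:R * x < X0 l w)%R]) &
      mutual_indep P [set i : idx | match i with
                                     | inl (inr (_, n)) => n != 0%R
                                     | _ => True end]
        (fun i : idx => match i with
                        | inl (inl l) => rv2_events (fun w => - T l 0%R w)%R (T l 1%R)
                        | inl (inr (l, n)) => rv_events (gap T l n)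
                        | inr (l, n) => rv_events (V l n) end)].

Definition present (T V : 'I_L -> int -> Omega -> R) (w : Omega) (u : R)
  (ln : 'I_L * int) : Prop :=
  (T ln.1 ln.2 w <= u < T ln.1 ln.2 w + V ln.1 ln.2 w)%R.

(* Q_j(u, 0) <= c in the infinite-server network: no c+1 distinct jobs
   using station j are present at time u *)
Definition Q_le (T V : 'I_L -> int -> Omega -> R) (w : Omega) (j : 'I_J) (u : R)
  (c : nat) : Prop :=
  forall js : seq ('I_L * int), uniq js ->
    (forall ln, ln \in js -> Pm ln.1 j /\ present T V w u ln) ->
    (size js <= c)%N.

Definition Rmax (T V : 'I_L -> int -> Omega -> R) (w : Omega) (t : R) : \bar R :=
  ereal_sup ([set ((T ln.1 ln.2 w + V ln.1 ln.2 w - t)%R)%:E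
                | ln in present T V w t] `|` [set 0]).

(* tau' for the s-th system (C_j^s = s C_j), as an extended real
   (sup of the empty set is -oo) *)
Definition tau' (C : 'I_J -> nat) (s : nat) (T V : 'I_L -> int -> Omega -> R)
  (w : Omega) : \bar R :=
  ereal_sup [set t%:E | t in [set t : R | (t < 0)%R /\
     Rmax T V w t <= `|t|%:E /\
     (forall (j : 'I_J) (u : R), (t <= u <= t + fine (Rmax T V w t))%R ->
        Q_le T V w j u (s * C j))]].

End network.

(* Main.v *)
Require Import Defs.
From HB Require Import structures.
From mathcomp Require Import finmap.
From mathcomp Require Import all_boot all_order all_algebra.
From mathcomp Require Import all_classical all_reals all_analysis.
From mathcomp Require Import measurable_realfun lra ring zify.
Import Order.TTheory GRing.Theory Num.Theory.
Local Open Scope classical_set_scope.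
Local Open Scope ring_scope.

(** Time is read backwards: the n-th arrival before 0 on a route has age
[back_age n], and the ages form a delayed renewal sequence. The delay may have
infinite mean, so the candidate times -(y_i + r), with y_i = 2^(i+1) r, are
deterministic. Such a candidate fails only if, on some route, (a) arrivals
since the last one before -y_i are denser than a rate mu/s slightly above the
nominal one, (b) some service time is too long for its age, or (c) too many
service times exceed the age guaranteed by (a). Each of these has small
probability uniformly in the starting index: (a) and (c) by Chernoff bounds
(only upper deviations of the renewal count matter, so E X < oo suffices) and
(b) by moments of V. Given the index of the last arrival before -y_i, the part
of the failure caused by jobs arrived after -y_(i+1) is independent of
everything later, so k consecutive failures have probability at most p^k; jobs
arrived before -y_(i+1) matter with probability at most 16^-i. Hence
P(|tau'| > y_(2k) + r) <= 2 * 8^-k for large s, which beats y_(2k) ~ 2 * 4^k r,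
and E|tau'| <= 51 r with r = s^a for some a < delta. *)

(** A failed window is not decided by the jobs of its own time span: arbitrarily old jobs may enter
    it, so consecutive failures are dependent. Each failure therefore exists in two versions. The
    one truncated to indices below the next passage is known at that passage and can be conditioned
    on; the untruncated one contains it and involves only jobs from the current passage on, so it is
    independent of what came before. What truncation discards is charged to the far jobs.

    Stage [k] uses the windows [k <= i < 2k] and not the first [k], because the far-job error of
    window [i] is only of order [16^-i]; over these windows it adds up to at most [k 16^-k <= 8^-k].

    The overload events must hold for all starting shifts up to [M], since the count at age [u]
    starts at a random index, the first arrival older than [u]. As [M] is of order [r s <= s^2],
    each event needs probability of order [s^-4]. The same fourth power, taken at scale [2^i],
    produces [16^-i]. *)

(** * Independence of sigma-algebras generated by disjoint index sets *)

Section independence.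
Context {d : measure_display} {Omega : measurableType d} {R : realType}.
Variable P : probability Omega R.
Local Open Scope ereal_scope.

(** Both sides are finite measures in [A], and finite measures that agree on a pi-system containing
    the whole space agree on the sigma-algebra it generates. *)
Lemma pi_system_indep (G : set_system Omega) (B : set Omega) :
  G `<=` measurable -> G setT -> setI_closed G -> measurable B ->
  (forall A, G A -> P (A `&` B) = P A * P B) ->
  forall A, <<s G>> A -> P (A `&` B) = P A * P B.
Proof.
move=> Gm GT GI mB GB A sA.
pose c : {nonneg R} := NngNum (fine_ge0 (measure_ge0 P B)).
have PBE : (fine (P B))%:E = P B by rewrite fineK// fin_num_measure.
have cover : \bigcup_(k : nat) [set: Omega] = setT by apply/seteqP; split=> // w _; exists 0%N.
have E := @g_sigma_algebra_measure_unique _ _ _ G Gm (fun=> setT) (fun=> GT)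
  cover (mrestr P mB) (mscale c P) GI.
have mA C : mrestr P mB C = P (C `&` B) by [].
have cA C : mscale c P C = P C * P B by rewrite -PBE muleC.
rewrite -mA -cA; apply: E => // [C GC|_].
  by transitivity (P (C `&` B)) => //; rewrite GB// -cA.
change (P (setT `&` B) < +oo); rewrite setTI ltey_eq fin_num_measure//.
Qed.

Variables (I : choiceType) (D : set I) (F : I -> set_system Omega).

Definition gens (S : set I) : set_system Omega := [set A | exists2 i, S i & F i A].

(** [gens S] is not closed under intersection; these finite intersections form the pi-system needed
    for uniqueness of measures. *)
Definition cylinders (S : set I) : set_system Omega :=
  [set A | exists J (E : I -> set Omega),
    [/\ uniq J, (forall i, i \in J -> S i /\ F i (E i)) &
        A = \bigcap_(i in [set` J]) E i]].

Hypotheses (Fm : forall i, F i `<=` measurable) (FT : forall i, F i setT)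
  (FI : forall i, setI_closed (F i)).

Lemma cylinders_measurable S : cylinders S `<=` measurable.
Proof.
move=> _ [J [E [_ JE ->]]]; rewrite bigcap_seq big_seq.
apply: big_ind => [||i /JE[_ /Fm]//]; [exact: measurableT|exact: measurableI].
Qed.

Lemma cylindersT S : cylinders S setT.
Proof. by exists [::], (fun=> setT); split=> //; rewrite bigcap_seq big_nil. Qed.

Lemma cylindersI S : setI_closed (cylinders S).
Proof.
move=> _ _ [J1 [E1 [u1 JE1 ->]]] [J2 [E2 [u2 JE2 ->]]].
pose cut (J : seq I) (E : I -> set Omega) i := if i \in J then E i else setT.
exists (undup (J1 ++ J2)), (fun i => cut J1 E1 i `&` cut J2 E2 i); split.
- exact: undup_uniq.
- move=> i; rewrite mem_undup mem_cat => iJ; split.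
    by case/orP: iJ => [/JE1[]|/JE2[]].
  apply: FI; rewrite /cut; case: ifPn => // i12; [by have [] := JE1 _ i12|].
  by have [] := JE2 _ i12.
- apply/seteqP; split=> w.
    move=> [w1 w2] i _; split; rewrite /cut; case: ifPn => // iJ; [exact: w1|exact: w2].
  move=> w12; split=> i /= iJ.
    have /w12[] : [set` undup (J1 ++ J2)] i by rewrite /= mem_undup mem_cat iJ.
    by rewrite /cut iJ.
  have /w12[] : [set` undup (J1 ++ J2)] i by rewrite /= mem_undup mem_cat iJ orbT.
  by rewrite /cut iJ.
Qed.

Lemma sub_cylinders S : gens S `<=` cylinders S.
Proof.
move=> A [i Si FiA]; exists [:: i], (fun=> A); split=> //.
  by move=> j; rewrite inE => /eqP ->.
by rewrite bigcap_seq big_seq1.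
Qed.

(** The pi-system argument is applied once to each factor. On two cylinders the product rule is
    [mutual_indep] for the concatenated index lists, which have no repetition because [S1] and [S2]
    are disjoint. *)
Lemma mutual_indep_sigma (S1 S2 : set I) (A B : set Omega) :
  mutual_indep P D F -> S1 `<=` D -> S2 `<=` D -> S1 `&` S2 = set0 ->
  <<s gens S1>> A -> <<s gens S2>> B -> P (A `&` B) = P A * P B.
Proof.
move=> indP S1D S2D S12 sA sB.
have sc S C : <<s gens S>> C -> <<s cylinders S>> C.
  by apply: sub_smallest2r => //; exact: sub_cylinders.
have mc S C : <<s cylinders S>> C -> measurable C.
  by move: C; apply: smallest_sub; [exact: sigma_algebra_measurable|exact: cylinders_measurable].
have cc A' B' : cylinders S1 A' -> cylinders S2 B' -> P (A' `&` B') = P A' * P B'.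
  move=> [J1 [E1 [u1 JE1 ->]]] [J2 [E2 [u2 JE2 ->]]].
  have dis i : i \in J1 -> i \in J2 -> False.
    move=> /JE1[i1 _] /JE2[i2 _].
    by have : (S1 `&` S2) i by []; rewrite S12.
  pose E i := if i \in J1 then E1 i else E2 i.
  have E1E : {in J1, E1 =1 E} by move=> i iJ; rewrite /E iJ.
  have E2E : {in J2, E2 =1 E}.
    by move=> i iJ; rewrite /E; case: ifPn => // /dis /(_ iJ).
  rewrite !bigcap_seq.
  rewrite (eq_big_seq _ E1E) (eq_big_seq _ E2E) -big_cat/=.
  rewrite !indP//=.
  - by rewrite big_cat EFinM.
  - by move=> i iJ; rewrite -E2E//; have [/S2D ? ?] := JE2 _ iJ.
  - by move=> i iJ; rewrite -E1E//; have [/S1D ? ?] := JE1 _ iJ.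
  - rewrite cat_uniq u1 u2 andbT /=; apply/hasPn => i i2; apply/negP => i1.
    exact: dis i1 i2.
  - move=> i; rewrite mem_cat => /orP[] iJ.
      by rewrite -E1E//; have [/S1D ? ?] := JE1 _ iJ.
    by rewrite -E2E//; have [/S2D ? ?] := JE2 _ iJ.
have half A' B' : cylinders S1 A' -> <<s gens S2>> B' -> P (B' `&` A') = P B' * P A'.
  move=> cA /sc; apply: pi_system_indep.
  - exact: cylinders_measurable.
  - exact: cylindersT.
  - exact: cylindersI.
  - exact: cylinders_measurable cA.
  - by move=> C cC; rewrite setIC muleC cc.
move: (sc _ _ sA); apply: pi_system_indep.
- exact: cylinders_measurable.
- exact: cylindersT.
- exact: cylindersI.
- exact: (mc S2 _ (sc _ _ sB)).
- by move=> C cC; rewrite setIC muleC half.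
Qed.

End independence.

(** * Chernoff bounds over finitely many cells *)

Section finite_chernoff.
Context {d : measure_display} {Omega : measurableType d} {R : realType}.
Variable P : probability Omega R.

Lemma measure_bigsetU_le (I : Type) (s : seq I) (A : I -> set Omega) :
  (forall i, measurable (A i)) ->
  (P (\big[setU/set0]_(i <- s) A i) <= \sum_(i <- s) P (A i))%E.
Proof.
move=> mA; elim: s => [|i s IH]; first by rewrite !big_nil measure0.
rewrite !big_cons; apply: (le_trans (measureU2 _ _ _)) => //.
  by apply: big_ind => //; exact: measurableU.
by rewrite leeD2l.
Qed.

Variables (I : choiceType) (D : set I) (F : I -> set_system Omega).
Hypotheses (Fm : forall i, F i `<=` measurable) (indP : mutual_indep P D F).

Section product.
Variables (n : nat) (e : 'I_n -> I).
Hypotheses (einj : injective e) (eD : forall i, D (e i)).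

(** [mutual_indep] wants events indexed by all of [I], so the family is transported along [e] and
    completed by [setT]. *)
Lemma mutual_indep_ord (E : 'I_n -> set Omega) : (forall i, F (e i) (E i)) ->
  P (\big[setI/setT]_(i < n) E i) = (\prod_(i < n) fine (P (E i)))%:E.
Proof.
move=> FE.
pose E' x := if [pick k | e k == x] is Some k then E k else setT.
have E'e k : E' (e k) = E k.
  rewrite /E'; case: pickP => [j /eqP/einj -> //|/(_ k)]; by rewrite eqxx.
have := @indP [seq e i | i <- index_enum 'I_n] E'.
rewrite !big_map /=.
rewrite (eq_bigr E) => [|i _]; last exact: E'e.
rewrite (eq_bigr (fun i => fine (P (E i)))) => [|i _]; last by rewrite E'e.
apply; first by rewrite map_inj_uniq ?index_enum_uniq.
by move=> _ /mapP[k _ ->]; rewrite E'e.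
Qed.

(* Markov's inequality for a product of independent functions, stated for
   finitely many cells so that no integral of a product is needed. *)
Lemma finite_chernoff (A : finType) (E : 'I_n -> A -> set Omega)
  (g : 'I_n -> A -> R) (B : set Omega) (c : R) :
  (forall i a, F (e i) (E i a)) -> (forall i w, exists a, E i a w) ->
  measurable B -> 0 <= c -> (forall i a, 0 <= g i a) ->
  (forall w, B w -> forall f : {ffun 'I_n -> A}, (forall i, E i (f i) w) ->
    c <= \prod_i g i (f i)) ->
  (c%:E * P B <= (\prod_i \sum_a g i a * fine (P (E i a)))%:E)%E.
Proof.
move=> FE cov mB c0 g0 Bg.
pose Ef (f : {ffun 'I_n -> A}) := \big[setI/setT]_(i < n) E i (f i).
have mEf f : measurable (Ef f).
  by apply: big_ind => // [|i _]; [exact: measurableI|exact: Fm (FE _ _)].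
have Efw f w : Ef f w <-> forall i, E i (f i) w.
  rewrite /Ef; split=> [+ i|Ew]; first by rewrite (bigD1 i)//= => -[].
  by apply: (big_ind (fun S : set Omega => S w)) => //; move=> S T; split.
have BE : B = \big[setU/set0]_(f <- index_enum {ffun 'I_n -> A}) (B `&` Ef f).
  rewrite -bigcup_seq_cond -setI_bigcupr.
  apply/seteqP; split=> [w Bw|w []//]; split=> //.
  have /choice[f fE] : forall i, exists a, E i a w by move=> i; exact: cov.
  exists [ffun i => f i]; first by rewrite /= mem_index_enum.
  by apply/Efw => i; rewrite ffunE.
rewrite bigA_distr_bigA/= {1}BE.
apply: (@le_trans _ _ (c%:E * \sum_(f <- index_enum {ffun 'I_n -> A}) P (B `&` Ef f))%E).
  by rewrite lee_wpmul2l ?lee_fin// measure_bigsetU_le// => f; exact: measurableI.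
rewrite ge0_sume_distrr// -sumEFin; apply: lee_sum => f _.
(* An empty cell gives no information on [c] and contributes nothing; a nonempty one has a point at
   which the hypothesis bounds [c] by the product. *)
have [->|/set0P[w [Bw /Efw Efw']]] := eqVneq (B `&` Ef f) set0.
  by rewrite measure0 mule0 lee_fin prodr_ge0// => i _; rewrite mulr_ge0 ?fine_ge0.
rewrite big_split/= EFinM -mutual_indep_ord//.
apply: lee_pmul => //; first by rewrite lee_fin; exact: Bg Bw _ Efw'.
apply: le_measure; rewrite ?inE; [exact: measurableI|exact: (mEf f)|exact: subIsetr].
Qed.

End product.

(** From [exp (-x) >= 1 - x] one has [(1 - x) exp x <= 1], while [(1 - x)(1 + x + 2 x^2) = 1 + x^2
    (1 - 2 x) >= 1]. *)
Lemma expR_le_quad (x : R) : `|x| <= 2^-1 -> expR x <= 1 + x + 2 * x ^+ 2.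
Proof.
rewrite ler_norml => /andP[x1 x2].
have := expR_ge1Dx (- x); rewrite expRN => h.
have e0 := expR_gt0 x.
have h' : (1 - x) * expR x <= 1 by rewrite -ler_pdivlMr// mul1r.
have : (1 - x) * (1 + x + 2 * x ^+ 2) >= 1 by nra.
nra.
Qed.

(** The moment generating function is 1 at 0 with slope the negative mean, so it drops below 1 for
    small [t]. *)
Lemma exp_moment_lt1 (A : finType) (q x : A -> R) :
  (forall a, 0 <= q a) -> \sum_a q a = 1 -> \sum_a x a * q a < 0 ->
  exists2 t, 0 < t & \sum_a expR (t * x a) * q a < 1.
Proof.
move=> q0 q1 xq; set m := \sum_a _ in xq.
pose K := 1 + \sum_a `|x a|.
have xK a : `|x a| <= K.
  rewrite /K (bigD1 a)//=.
  have : 0 <= \sum_(i | i != a) `|x i| by apply: sumr_ge0.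
  have := normr_ge0 (x a); lra.
have K1 : 1 <= K by rewrite lerDl sumr_ge0.
(* The first bound makes [t |x a| <= 1/2], as the quadratic estimate requires; the second makes the
   quadratic term at most half of [- t m]. *)
pose t := Num.min (2 * K)^-1 (- m / (4 * K ^+ 2)).
have t0 : 0 < t.
  by rewrite lt_min invr_gt0 divr_gt0 ?andbT; nra.
have tK : t * K <= 2^-1.
  have h : t <= (2 * K)^-1 by rewrite ge_min lexx.
  have K0 : 0 < K by lra.
  apply: (@le_trans _ _ ((2 * K)^-1 * K)); first by rewrite ler_pM2r.
  by rewrite invfM mulfVK ?gt_eqF.
have tm : 4 * t * K ^+ 2 <= - m.
  have : t <= - m / (4 * K ^+ 2) by rewrite ge_min lexx orbT.
  by rewrite ler_pdivlMr; nra.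
exists t => //.
apply: (@le_lt_trans _ _ (\sum_a (q a + t * (x a * q a) + 2 * (t * K) ^+ 2 * q a))).
  apply: ler_sum => a _.
  have h : expR (t * x a) <= 1 + t * x a + 2 * (t * x a) ^+ 2.
    apply: expR_le_quad; rewrite normrM (gtr0_norm t0).
    by apply: le_trans tK; rewrite ler_pM2l.
  have h2 : (t * x a) ^+ 2 <= (t * K) ^+ 2.
    have /andP[x1 x2] : - K <= x a <= K by rewrite -ler_norml.
    by rewrite !exprMn ler_wpM2l ?sqr_ge0//; nra.
  have := q0 a; nra.
rewrite !big_split/= -!mulr_sumr q1 -/m exprMn.
nra.
Qed.

End finite_chernoff.

Lemma measurable_set_lt {d : measure_display} {T : measurableType d} {R : realType}
  (f g : T -> R) : measurable_fun setT f -> measurable_fun setT g ->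
  measurable [set x | f x < g x].
Proof.
move=> mf mg; have := measurable_lte (measurableT : measurable [set: T])
  ((measurable_EFinP _ _).2 mf) ((measurable_EFinP _ _).2 mg).
by rewrite setTI.
Qed.

Lemma measurable_set_le {d : measure_display} {T : measurableType d} {R : realType}
  (f g : T -> R) : measurable_fun setT f -> measurable_fun setT g ->
  measurable [set x | f x <= g x].
Proof.
move=> mf mg; have := measurable_lee (measurableT : measurable [set: T])
  ((measurable_EFinP _ _).2 mf) ((measurable_EFinP _ _).2 mg).
by rewrite setTI.
Qed.

(** * Tails of counts and of renewal sums *)

Section tails.
Context {d : measure_display} {Omega : measurableType d} {R : realType}.
Variables (P : probability Omega R) (I : choiceType) (D : set I)
  (F : I -> set_system Omega) (n : nat) (e : 'I_n -> I).
Hypotheses (Fm : forall i, F i `<=` measurable) (indP : mutual_indep P D F)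
  (einj : injective e) (eD : forall i, D (e i)).

(** An indicator of probability [p] has exponential moment
    [1 + p (exp t - 1) <= exp ((t + 2 t^2) p)], so only the sum of the probabilities matters, not
    their individual values. *)
Lemma count_tail (U : 'I_n -> set Omega) (m z t : R) :
  (forall i, F (e i) (U i) /\ F (e i) (~` U i)) ->
  0 <= t <= 2^-1 -> \sum_i fine (P (U i)) <= m ->
  (P [set w | (z < \sum_i \1_(U i) w)%R] <= (expR ((t + 2 * t ^+ 2) * m - t * z))%:E)%E.
Proof.
move=> FU /andP[t0 t1] Um.
have mU i : measurable (U i) by apply: Fm (proj1 (FU i)).
set B := [set w | _].
have mB : measurable B.
  apply: measurable_set_lt => //.
  by apply: measurable_sum => i; exact: measurable_indic.
have := @finite_chernoff _ _ _ P _ D F Fm indP n e einj eD bool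
  (fun i b => if b then U i else ~` U i) (fun i b => if b then expR t else 1) B (expR (t * z))
  _ _ mB (expR_ge0 _).
have -> : expR ((t + 2 * t ^+ 2) * m - t * z) =
   (expR (t * z))^-1 * expR ((t + 2 * t ^+ 2) * m) by rewrite -expRN -expRD addrC.
rewrite EFinM lee_pdivlMl ?expR_gt0// => H.
apply: (le_trans (H _ _ _ _)).
- by move=> i []; have [] := FU i.
- move=> i w; have [Uw|Uw] := pselect (U i w); by [exists true|exists false].
- by move=> i []; rewrite ?expR_ge0.
- move=> w Bw f fw.
  rewrite (eq_bigr (fun i => expR (t * \1_(U i) w))) => [|i _].
    by rewrite -expR_sum ler_expR -mulr_sumr ler_wpM2l// ltW.
  have := fw i; rewrite indicE; case: (f i) => [Uw|Uw].
    by rewrite mem_set// mulr1.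
  by rewrite memNset// mulr0 expR0.
rewrite lee_fin; apply: (@le_trans _ _ (\prod_i expR ((t + 2 * t ^+ 2) * fine (P (U i))))).
  apply: ler_prod => i _; rewrite big_bool/= probability_setC// mul1r.
  have : fine (1 - P (U i))%E = 1 - fine (P (U i)).
    by rewrite fineB ?fin_num_measure.
  move=> ->.
  have p0 : 0 <= fine (P (U i)) by rewrite fine_ge0.
  have p1 : fine (P (U i)) <= 1.
    by rewrite -lee_fin fineK ?fin_num_measure ?probability_le1.
  have et0 := expR_gt0 t.
  apply/andP; split; first nra.
  apply: le_trans (expR_ge1Dx _).
  have := @expR_le_quad _ t; rewrite ger0_norm// => /(_ t1).
  nra.
rewrite -expR_sum ler_expR -mulr_sumr ler_wpM2l//.
nra.
Qed.

(** The cells are the level sets of [phi]; on the event, the product of the factors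
    [exp (t (mu - phi))] is at least 1. *)
Lemma sum_tail (A : {fset R}) (phi : R -> R) (Q : {measure set R -> \bar R}) (mu t : R)
  (Y : 'I_n -> Omega -> R) :
  measurable_fun setT phi -> (forall y, phi y \in A) ->
  (forall i B, measurable B -> F (e i) (Y i @^-1` B) /\ P (Y i @^-1` B) = Q B) ->
  0 < t ->
  (P [set w | (\sum_i phi (Y i w) < n%:R * mu)%R] <=
   ((\sum_(a : A) expR (t * (mu - val a)) * fine (Q (phi @^-1` [set val a]))) ^+ n)%:E)%E.
Proof.
move=> mphi phiA FY t0.
have mpre (a : R) : measurable (phi @^-1` [set a]).
  by rewrite -[X in measurable X]setTI; exact: mphi.
have mY i : measurable_fun setT (Y i).
  by move=> _ B mB; rewrite setTI; apply: Fm (proj1 (FY i B mB)).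
set B := [set w | _].
have mB : measurable B.
  apply: measurable_set_lt => //.
  by apply: measurable_sum => i; exact: measurableT_comp.
have := @finite_chernoff _ _ _ P _ D F Fm indP n e einj eD A
  (fun i a => Y i @^-1` (phi @^-1` [set val a])) (fun i a => expR (t * (mu - val a))) B 1
  _ _ mB ler01.
rewrite mul1e => H; apply: (le_trans (H _ _ _ _)).
- by move=> i a; have [] := FY i _ (mpre (val a)).
- by move=> i w; exists [` phiA (Y i w)]%fset.
- by move=> i a; exact: expR_ge0.
- move=> w Bw f fw.
  rewrite -expR_sum -expR0 ler_expR -mulr_sumr mulr_ge0// ?(ltW t0)//.
  rewrite sumrB sumr_const card_ord -mulr_natl subr_ge0.
  rewrite (eq_bigr (fun i => phi (Y i w))) ?ltW// => i _; by rewrite (fw i).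
rewrite lee_fin -[X in _ ^+ X]card_ord -prodr_const.
rewrite le_eqVlt; apply/orP; left; apply/eqP; apply: eq_bigr => i _.
by apply: eq_bigr => a _; have [_ ->] := FY i _ (mpre (val a)).
Qed.

End tails.

Import HBNNSimple.

(* A nonnegative simple function below the identity that still has mean above
   [mu] reduces the renewal sum to finitely many cells. *)
Lemma renewal_rate {R : realType} (Q : probability R R) (mu : R) :
  (mu%:E < \int[Q]_y (Num.max y 0)%:E)%E ->
  exists rho, 0 <= rho < 1 /\ forall (d : measure_display) (Omega : measurableType d)
    (P : probability Omega R) (I : choiceType) (D : set I) (F : I -> set_system Omega)
    (n : nat) (e : 'I_n -> I) (Y : 'I_n -> Omega -> R),
  (forall i, F i `<=` measurable) -> mutual_indep P D F ->
  injective e -> (forall i, D (e i)) ->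
  (forall i B, measurable B -> F (e i) (Y i @^-1` B) /\ P (Y i @^-1` B) = Q B) ->
  (P [set w | (\sum_i Num.max (Y i w) 0 < n%:R * mu)%R] <= (rho ^+ n)%:E)%E.
Proof.
rewrite ge0_integralTE; last by move=> y; rewrite lee_fin le_max lexx orbT.
move=> /ereal_sup_gt[_ [h /= hle <-]].
rewrite sintegralE fsbig_finite//=.
set A := fset_set _.
have hA y : h y \in A by rewrite /A in_fset_set; [apply: mem_set; exists y|exact: fimfunP].
have mpre (a : R) : measurable (h @^-1` [set a]).
  by apply: measurable_funPTI; exact: measurable_set1.
rewrite big_seq_fsetE/=.
pose q (a : A) := fine (Q (h @^-1` [set val a])).
rewrite (eq_bigr (fun a : A => (val a * q a)%:E)) => [|a _]; last first.
  by rewrite EFinM fineK// fin_num_measure.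
rewrite sumEFin lte_fin => hm.
have q0 a : 0 <= q a by rewrite fine_ge0.
have q1 : \sum_a q a = 1.
  apply: EFin_inj; rewrite -(@probability_setT _ _ _ Q) -sumEFin.
  rewrite (eq_bigr (fun a : A => Q (h @^-1` [set val a]))) => [|a _]; last first.
    by rewrite fineK// fin_num_measure.
  rewrite -(big_seq_fsetE _ A xpredT (fun x => Q (h @^-1` [set x])))/=.
  rewrite -fsbig_finite// -measure_fin_bigcup//; last first.
    by move=> a b _ _ [y [<- <-]].
  by congr (Q _); apply/seteqP; split=> // y _; exists (h y).
have [|t t0 tq] := @exp_moment_lt1 R A q (fun a => mu - val a) q0 q1.
  under eq_bigr do rewrite mulrBl.
  by rewrite sumrB -mulr_sumr q1 mulr1 subr_lt0.
exists (\sum_a expR (t * (mu - val a)) * q a); split.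
  by rewrite tq andbT sumr_ge0// => a _; rewrite mulr_ge0 ?expR_ge0.
move=> d Omega P I D F n e Y Fm indP einj eD FY.
have mY i : measurable_fun setT (Y i).
  by move=> _ B mB; rewrite setTI; apply: Fm (proj1 (FY i B mB)).
apply: le_trans (@sum_tail _ _ _ P I D F n e Fm indP einj eD A h Q mu t Y _ hA FY t0) => //.
apply: le_measure; rewrite ?inE.
- apply: measurable_set_lt => //; apply: measurable_sum => i.
  by apply: measurable_maxr.
- apply: measurable_set_lt => //; apply: measurable_sum => i; exact: measurableT_comp.
- move=> w /=; apply: le_lt_trans; apply: ler_sum => i _.
  by have := hle (Y i w); rewrite lee_fin.
Qed.

(** * Stopping at a random index, and runs of failures *)

Section countable_partition.
Context {d : measure_display} {Omega : measurableType d} {R : realType}.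
Variable P : probability Omega R.

Lemma bigcup_countType_measurable {d' : measure_display} {T' : measurableType d'}
  (B : countType) (E : B -> set T') :
  (forall b, measurable (E b)) -> measurable (\bigcup_b E b).
Proof.
move=> mE; rewrite (_ : \bigcup_b _ = \bigcup_n (if pickle_inv n is Some b then E b else set0)).
  by apply: bigcup_measurable => n _; case: pickle_inv.
apply/seteqP; split=> w; first by move=> [b _ Eb]; exists (pickle b); rewrite ?pickleK_inv.
by move=> [n _]; case: pickle_inv => // b Eb; exists b.
Qed.

Lemma partition_le (B : countType) (K E : B -> set Omega) (F : set Omega) (c : R) :
  (forall b, measurable (K b)) -> (forall b, measurable (E b)) -> measurable F ->
  (forall a b w, K a w -> K b w -> a = b) -> 0 <= c ->
  (forall b, P (K b `&` E b) <= c%:E * P (K b `&` F))%E ->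
  (P (\bigcup_b (K b `&` E b)) <= c%:E * P F)%E.
Proof.
move=> mK mE mF Kinj c0 KE.
pose G (H : B -> set Omega) (n : nat) := if pickle_inv n is Some b then H b else set0.
have mG H : (forall b, measurable (H b)) -> forall n, measurable (G H n).
  by move=> mH n; rewrite /G; case: pickle_inv.
have mKE b : measurable (K b `&` E b) by exact: measurableI.
have mKF b : measurable (K b `&` F) by exact: measurableI.
apply: (@le_trans _ _ (\sum_(0 <= n <oo) P (G (fun b => K b `&` E b) n))%E).
  apply: measure_sigma_subadditive.
  - by move=> n; exact: mG.
  - exact: bigcup_countType_measurable.
  - by move=> w [b _ Eb]; exists (pickle b); rewrite /G ?pickleK_inv.
apply: (@le_trans _ _ (\sum_(0 <= n <oo) c%:E * P (G (fun b => K b `&` F) n))%E).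
  apply: lee_nneseries => [n _ _|n _]; first exact: measure_ge0.
  by rewrite /G; case: pickle_inv => [b|]; rewrite ?measure0 ?mule0.
rewrite nneseriesZl; last by move=> n _; exact: measure_ge0.
rewrite lee_wpmul2l ?lee_fin// -measure_semi_bigcup.
- apply: le_measure; rewrite ?inE//.
    by apply: bigcup_measurable => n _; exact: mG.
  by move=> w [n _]; rewrite /G; case: pickle_inv => // b [].
- by move=> n; exact: mG.
- move=> i j _ _ [w []]; rewrite /G.
  have := @pickle_invK B i; have := @pickle_invK B j; rewrite /ocancel.
  case: (pickle_inv i) => [a|//]; case: (pickle_inv j) => [b|//] /= <- <- [Ka _] [Kb _].
  by rewrite (Kinj _ _ _ Ka Kb).
- by apply: bigcup_measurable => n _; exact: mG.
Qed.

Variables (B : countType) (leB : rel B) (past fut : B -> set_system Omega)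
  (K : nat -> B -> set Omega).
Hypotheses (pastm : forall b, past b `<=` measurable)
  (futm : forall b, fut b `<=` measurable)
  (pastI : forall b, setI_closed (past b))
  (past_le : forall a b, leB a b -> past a `<=` past b)
  (indep : forall b E C, past b E -> fut b C -> (P (E `&` C) = P E * P C)%E)
  (pastK : forall i b, past b (K i b))
  (Kinj : forall i a b w, K i a w -> K i b w -> a = b).

(** A form of the strong Markov property: given that level [i] is passed at [b], the event [N b]
    keeps its unconditional probability. *)
Lemma stopped_le (i : nat) (N : B -> set Omega) (nu : R) : 0 <= nu ->
  (forall b, fut b (N b)) -> (forall b, (P (N b) <= nu%:E)%E) ->
  (P (\bigcup_b (K i b `&` N b)) <= nu%:E)%E.
Proof.
move=> nu0 fN PN.
rewrite -[leRHS]mule1 -(@probability_setT _ _ _ P); apply: partition_le => //.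
- by move=> b; exact/pastm/pastK.
- by move=> b; exact/futm/fN.
- by move=> a b w; exact: Kinj.
- move=> b; rewrite setIT (indep _ _ _ (pastK i b) (fN b)) muleC.
  exact: lee_wpmul2r.
Qed.

Variables (V : B -> B -> set Omega) (Vi : B -> set Omega) (p : R).
Hypotheses (p0 : 0 <= p) (pastV : forall a b, leB a b -> past b (V a b))
  (VVi : forall a b, V a b `<=` Vi a) (futVi : forall a, fut a (Vi a))
  (PVi : forall a, (P (Vi a) <= p%:E)%E).

(* [bad_run i m a]: the [m] windows from level [i] on, the first of which starts
   at index [a], all fail; [K i b] says that level [i] is first passed at [b]. *)
Fixpoint bad_run (i m : nat) (a : B) : set Omega :=
  if m is m'.+1 then
    \bigcup_b (K i.+1 b `&` (if leB a b then V a b `&` bad_run i.+1 m' b else set0))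
  else setT.

Lemma bad_run_measurable i m a : measurable (bad_run i m a).
Proof.
elim: m i a => [i a|m IH i a]; rewrite /bad_run -/bad_run.   exact: measurableT.
apply: (@bigcup_countType_measurable _ Omega B) => b.
apply: measurableI; first exact/pastm/pastK.
by case: ifPn => // ab; apply: measurableI => //; apply/pastm/pastV.
Qed.

(** The event [A] is general so that it can absorb history: [V a b] lies in [past b], so it joins
    [A] before the induction hypothesis is used at [b]. Afterwards [V a b] is enlarged to [Vi a],
    which no longer depends on [b] and is independent of [A]; this yields one factor [p]. *)
Lemma bad_run_le i m a (A : set Omega) : past a A ->
  (P (A `&` bad_run i m a) <= (p ^+ m)%:E * P A)%E.
Proof.
elim: m i a A => [|m IH] i a A pA; first by rewrite /= setIT expr0 mul1e.
rewrite /= setI_bigcupr.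
under eq_bigcupr do rewrite setICA.
rewrite exprS EFinM -muleA muleCA.
apply: (@le_trans _ _ ((p ^+ m)%:E * P (A `&` Vi a))%E); last first.
  rewrite lee_wpmul2l ?lee_fin ?exprn_ge0// (indep _ _ _ pA (futVi a)) muleC.
  exact: lee_wpmul2r.
have mA : measurable A by exact: (pastm _ _ pA).
have mVi : measurable (Vi a) by exact: (futm _ _ (futVi a)).
apply: partition_le.
- by move=> b; exact/pastm/pastK.
- move=> b; apply: measurableI => //; case: ifPn => // ab.
  by apply: measurableI; [exact/pastm/pastV|exact: bad_run_measurable].
- exact: measurableI.
- by move=> b c w; exact: Kinj.
- exact: exprn_ge0.
- move=> b; case: ifPn => ab; last first.
    by rewrite !setI0 measure0 mule_ge0// lee_fin exprn_ge0.
  have pKAV : past b (K i.+1 b `&` (A `&` V a b)).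
    by apply: pastI => //; apply: pastI; [exact: (past_le _ _ ab _ pA)|exact: pastV].
  rewrite (_ : _ `&` _ = (K i.+1 b `&` (A `&` V a b)) `&` bad_run i.+1 m b); last by rewrite !setIA.
  apply: (le_trans (IH i.+1 b _ pKAV)).
  rewrite lee_wpmul2l ?lee_fin ?exprn_ge0//; apply: le_measure; rewrite ?inE.
  + exact: (pastm _ _ pKAV).
  + by apply: measurableI; [exact/pastm/pastK|exact: measurableI].
  + by move=> w [? [? /VVi]].
Qed.

Lemma bad_runs_le i m :
  (P (\bigcup_a (K i a `&` bad_run i m a)) <= (p ^+ m)%:E)%E.
Proof.
rewrite -[leRHS]mule1 -(@probability_setT _ _ _ P); apply: partition_le => //.
- by move=> b; exact/pastm/pastK.
- by move=> b; exact: bad_run_measurable.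
- by move=> a b w; exact: Kinj.
- exact: exprn_ge0.
- by move=> b; rewrite setIT; exact/bad_run_le/pastK.
Qed.

End countable_partition.

(** * Deterministic analysis of one route *)

Section path.
Context {R : realType}.
Variables (tau xi v : nat -> R).
Hypotheses (tauS : forall n, tau n.+1 = tau n + xi n) (xi0 : forall n, 0 <= xi n).

Lemma tau_psum k j : tau (k + j)%N = tau k + \sum_(i < j) xi (k + i)%N.
Proof.
elim: j => [|j IH]; first by rewrite addn0 big_ord0 addr0.
by rewrite addnS tauS IH big_ord_recr/= addrA.
Qed.

Lemma tau_mono k n : (k <= n)%N -> tau k <= tau n.
Proof.
by move=> /subnKC <-; rewrite tau_psum lerDl sumr_ge0.
Qed.

Definition first_passage (y : R) (a : nat) :=
  y <= tau a /\ forall m, (m < a)%N -> tau m < y.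

Lemma first_passage_le y a n : first_passage y a -> y <= tau n -> (a <= n)%N.
Proof. by move=> [_ ya] yn; rewrite leqNgt; apply/negP => /ya; rewrite ltNge yn. Qed.

Variables (y r w y' c z : R) (a b M n0 n1 : nat).
Hypotheses (r0 : 0 <= r) (w0 : 0 <= w) (c0 : 0 < c) (z0 : 0 <= z)
  (yy' : y + r + w <= y') (Mr : r <= M%:R * c) (n0r : n0%:R * c <= r)
  (n1w : n1%:R * c <= w) (ya : first_passage y a) (yb : first_passage y' b).
Hypotheses
  (notslow : forall m j, (m <= M)%N -> (n0 <= j)%N -> (a + m + j < b)%N ->
     j%:R * c <= \sum_(i < j) xi (a + m + i)%N)
  (notlong : forall m j, (m <= M)%N -> (a + m + j < b)%N ->
     v (a + m + j)%N <= Num.max r (j%:R * c))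
  (notcrowd : forall m, (m <= M)%N ->
     \sum_(j < M | (a + m + j < b)%N) (j%:R * c < v (a + m + j)%N)%R%:R <= z)
  (nextslow : forall j, (n1 <= j)%N -> j%:R * c <= \sum_(i < j) xi (b + i)%N)
  (nextlong : forall j, v (b + j)%N <= Num.max w (j%:R * c)).

(** Jobs from index [b] on have left before the window opens. If the bound [w] on the service time
    applies, the distance from [y + r] to [y'] covers it; if [j * c] applies, the growth of ages
    after [b] does, or again [w] when [j < n1]. *)
Lemma far_service n : (b <= n)%N -> v n <= tau n - (y + r).
Proof.
have [h1 h2 h3 h4] := And4 yy' Mr n0r n1w; have [h5 h6] := conj r0 w0.
move=> /subnKC <-; move: (n - b)%N => j; apply: le_trans (nextlong j) _.
have yb' : y' <= tau b by case: yb.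
have tj : tau b <= tau (b + j)%N by apply: tau_mono; exact: leq_addr.
rewrite ge_max; apply/andP; split; first lra.
have [jn|jn] := leqP n1 j; first by have := nextslow j jn; rewrite tau_psum; lra.
have : j%:R * c <= n1%:R * c by rewrite ler_pM2r// ler_nat ltnW.
lra.
Qed.

(** In forward time: a job that arrived by [-(y + r)] has left by [-y], so the maximal remaining
    service time at [-(y + r)] is at most [r]. *)
Lemma remaining_service n : y + r <= tau n -> v n <= tau n - y.
Proof.
have [h1 h2 h3 h4] := And4 yy' Mr n0r n1w; have [h5 h6] := conj r0 w0.
move=> xn; have [bn|nb] := leqP b n; first by have := far_service n bn; lra.
have an : (a <= n)%N by apply: (first_passage_le _ _ _ ya); lra.
have := notlong 0%N (n - a)%N isT; rewrite addn0 subnKC// => /(_ nb) /le_trans; apply.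
rewrite ge_max; apply/andP; split; first lra.
have [jn|jn] := leqP n0 (n - a)%N.
  have := notslow 0%N _ isT jn; rewrite addn0 subnKC// => /(_ nb).
  have := tau_psum a (n - a)%N; rewrite subnKC// => ->; have [] := ya; lra.
have : (n - a)%N%:R * c <= n0%:R * c by rewrite ler_pM2r// ler_nat ltnW.
lra.
Qed.

(* Indices are shifted to the first arrival older than [u]: beyond the first
   [n0] of them, the [j]-th job is present at age [u] only if its service time
   exceeds [j * c]. *)
Lemma window_load u (ns : seq nat) : y <= u <= y + r -> uniq ns ->
  (forall n, n \in ns -> u <= tau n /\ tau n - u < v n) ->
  (size ns)%:R <= n0%:R + z.
Proof.
have [h1 h2 h3 h4] := And4 yy' Mr n0r n1w; have [h5 h6] := conj r0 w0.
move=> /andP[yu ux] uns nsP.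
have nb n : n \in ns -> (n < b)%N.
  move=> /nsP[_ vn]; rewrite ltnNge; apply/negP => /far_service; lra.
have [->|[n nns]] : ns = [::] \/ exists n, n \in ns.
- by case: ns {uns nsP nb} => [|n ns]; [left|right; exists n; rewrite mem_head].
- by rewrite addr_ge0.
have exk : exists k, u <= tau k by exists n; have [] := nsP n nns.
case: (ex_minnP exk) => k uk kmin {exk}.
have kle m : m \in ns -> (k <= m)%N by move=> /nsP[um _]; exact: kmin.
have kb : (k < b)%N := leq_ltn_trans (kle _ nns) (nb _ nns).
have ak : (a <= k)%N by apply: (first_passage_le _ _ _ ya); lra.
have n0M : (n0 <= M)%N.
  by rewrite -(ler_nat R) -(ler_pM2r c0); lra.
pose m := (k - a)%N; have kE : (a + m)%N = k by rewrite subnKC.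
(* Otherwise the [M] gaps after [a] would add at least [M * c >= r], and [tau (a + M)] would already
   reach [u]. *)
have mM : (m <= M)%N.
  rewrite leqNgt; apply/negP => Mm.
  have aMk : (a + M < k)%N by rewrite -kE ltn_add2l.
  have : tau (a + M)%N < u.
    by rewrite ltNge; apply/negP => /kmin; rewrite leqNgt aMk.
  have := notslow 0%N M isT n0M; rewrite addn0 => /(_ (ltn_trans aMk kb)).
  by rewrite tau_psum; have [] := ya; lra.
pose js := [seq (i - k)%N | i <- ns].
have ujs : uniq js.
  rewrite map_inj_in_uniq// => i j /kle ki /kle kj ij.
  by rewrite -(subnKC ki) ij subnKC.
(* For [j >= M] one has [j * c >= r], so the age bound on service times reads [v <= j * c] and
   excludes presence; hence a count over [j < M] suffices. *)
have jsP j : j \in js -> (n0 <= j)%N -> [/\ (j < M)%N, (k + j < b)%N & j%:R * c < v (k + j)%N].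
  move=> /mapP[i ins ->] n0j; have ki := kle _ ins; rewrite subnKC//.
  have [ui vi] := nsP _ ins.
  have := notslow m _ mM n0j; rewrite kE subnKC// => /(_ (nb _ ins)) h7.
  have h8 := tau_psum k (i - k)%N; rewrite subnKC// in h8.
  have h9 : (i - k)%N%:R * c < v i by lra.
  split=> //; last exact: nb.
  rewrite ltnNge; apply/negP => Mj.
  have := notlong m (i - k)%N mM; rewrite kE subnKC// => /(_ (nb _ ins)).
  have : M%:R * c <= (i - k)%N%:R * c by rewrite ler_pM2r// ler_nat.
  by rewrite le_max => ? /orP[]; lra.
have -> : size ns = size js by rewrite size_map.
rewrite -(count_predC (fun j => j < n0)%N js) natrD lerD//.
  rewrite ler_nat -size_filter -[leqRHS](size_iota 0); apply: uniq_leq_size.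
    exact: filter_uniq.
  by move=> j; rewrite mem_filter mem_iota /= add0n => /andP[].
apply: le_trans (notcrowd m mM); rewrite kE.
rewrite -natr_sum ler_nat -size_filter.
rewrite (_ : (\sum_(j < M | (k + j < b)%N) _)%N =
  size [seq j <- iota 0 M | (k + j < b)%N && (j%:R * c < v (k + j)%N)]); last first.
  rewrite size_filter -sum1_count -(big_mkord (fun j => k + j < b)%N
    (fun j => (j%:R * c < v (k + j)%N)%R : nat)).
  rewrite /index_iota subn0 big_mkcondr/=; apply: eq_bigr => j _; by case: (_ < _).
apply: uniq_leq_size; first exact: filter_uniq.
move=> j; rewrite !mem_filter mem_iota/= -leqNgt => /andP[n0j jj].
by have [jM kj jv] := jsP _ jj n0j; rewrite add0n jM kj jv.
Qed.

End path.

(** * Overload events and their measurability *)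

Section events.
Context {R : realType} {T : Type}.
Variables (xi v : nat -> T -> R) (A : pred nat) (c : R).

(* [slow]: ages grow slower than [c] per arrival; [long]: a service time exceeds
   its age bound; [crowd]: too many service times exceed the age lower bound.
   [A] restricts attention to the jobs with admissible index. *)
Definition slow (n0 k : nat) : set T := [set w | exists j, [/\ (n0 <= j)%N, A (k + j)%N &
  \sum_(i < j) xi (k + i)%N w < j%:R * c]].

Definition long (r : R) (k : nat) : set T :=
  [set w | exists j, A (k + j)%N /\ Num.max r (j%:R * c) < v (k + j)%N w].

Definition crowd (M : nat) (z : R) (k : nat) : set T :=
  [set w | z < \sum_(j < M | A (k + j)%N) (j%:R * c < v (k + j)%N w)%R%:R].

Definition overload (n0 M : nat) (r z : R) (k : nat) : set T := slow n0 k `|` long r k `|` crowd M z k.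

End events.

Section events_measurable.
Context {R : realType} {d : measure_display} {T : measurableType d}.
Variables (xi v : nat -> T -> R) (A : pred nat) (c : R) (k : nat).
Hypotheses (Adown : forall i j, A j -> (i < j)%N -> A i)
  (mxi : forall i, (k <= i)%N -> A i -> measurable_fun setT (xi i))
  (mv : forall i, (k <= i)%N -> A i -> measurable_fun setT (v i)).

(** [T] is an arbitrary measurable space, so that it can later be [Omega] with the sigma-algebra of
    the admissible jobs only. [slow] at [k + j] uses all gaps before it, hence the downward closure
    of [A]. *)
Lemma slow_measurable n0 : measurable (slow xi A c n0 k).
Proof.
rewrite (_ : slow _ _ _ _ _ = \bigcup_j (if (n0 <= j)%N && A (k + j)%N then
  [set w | \sum_(i < j) xi (k + i)%N w < j%:R * c] else set0)); last first.
  apply/seteqP; split=> w.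
    by move=> [j [nj Aj wj]]; exists j => //; rewrite nj Aj.
  by move=> [j _]; case: ifPn => // /andP[nj Aj] wj; exists j.
apply: bigcup_measurable => j _; case: ifPn => // /andP[_ Aj].
apply: measurable_set_lt => //; apply: measurable_sum => i.
by apply: mxi; [exact: leq_addr|apply: Adown Aj _; rewrite ltn_add2l].
Qed.

Lemma long_measurable r : measurable (long v A c r k).
Proof.
rewrite (_ : long _ _ _ _ _ = \bigcup_j (if A (k + j)%N then
  [set w | Num.max r (j%:R * c) < v (k + j)%N w] else set0)); last first.
  apply/seteqP; split=> w.
    by move=> [j [Aj wj]]; exists j => //; rewrite Aj.
  by move=> [j _]; case: ifPn => // Aj wj; exists j.
apply: bigcup_measurable => j _; case: ifPn => // Aj.
by apply: measurable_set_lt => //; apply: mv => //; exact: leq_addr.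
Qed.

Lemma crowd_measurable M z : measurable (crowd v A c M z k).
Proof.
apply: measurable_set_lt => //.
under eq_fun do rewrite big_mkcond/=.
apply: measurable_sum => j; case: (boolP (A (k + j)%N)) => // Aj.
have -> : (fun w => (j%:R * c < v (k + j)%N w)%R%:R) =
    \1_([set w | (j%:R * c < v (k + j)%N w)%R]) :> (T -> R); last first.
  apply: measurable_indic; apply: measurable_set_lt => //.
  by apply: mv => //; exact: leq_addr.
apply/funext => w; rewrite indicE; congr (_%:R).
by case: (boolP (_ < _)) => h; [rewrite mem_set|rewrite memNset//; apply/negP].
Qed.

Lemma overload_measurable n0 M r z : measurable (overload xi v A c n0 M r z k).
Proof.
by apply: measurableU; [apply: measurableU|];
  [exact: slow_measurable|exact: long_measurable|exact: crowd_measurable].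
Qed.

End events_measurable.

(** * Union bound and elementary real estimates *)

Section union_bound.
Context {d : measure_display} {T : measurableType d} {R : realType}.
Variable P : probability T R.

Lemma bigcup_le (E : nat -> set T) (a : nat -> R) (S : R) :
  (forall j, measurable (E j)) -> (forall j, P (E j) <= (a j)%:E)%E ->
  (forall n, \sum_(j < n) a j <= S) -> (P (\bigcup_j E j) <= S%:E)%E.
Proof.
move=> mE PE aS.
apply: (@le_trans _ _ (\sum_(0 <= j <oo) P (E j))%E).
  by apply: measure_sigma_subadditive => //; exact: bigcup_measurable.
apply: lime_le; first by apply: is_cvg_nneseries => n _ _; exact: measure_ge0.
apply: nearW => n; rewrite big_mkord.
apply: (@le_trans _ _ (\sum_(j < n) (a j)%:E)%E); first by apply: lee_sum.
by rewrite sumEFin lee_fin.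
Qed.

End union_bound.

Section real_bounds.
Context {R : realType}.
Implicit Types (rho x c : R) (n : nat).

Lemma geometric_tail rho n0 n : 0 <= rho < 1 ->
  \sum_(j < n) rho ^+ (n0 + j) <= rho ^+ n0 / (1 - rho).
Proof.
move=> /andP[r0 r1]; rewrite ler_pdivlMr ?subr_gt0//.
under eq_bigr do rewrite exprD.
rewrite -mulr_sumr -mulrA ler_piMr ?exprn_ge0// mulrC.
rewrite -opprB mulNr -subrX1 opprB lerBlDr lerDl exprn_ge0//.
Qed.

Lemma expRN_le_quartic x : 0 < x -> expR (- x) <= 24 / x ^+ 4.
Proof.
move=> x0; rewrite expRN -[leRHS]invrK lef_pV2 ?posrE ?expR_gt0//; last first.
  by rewrite invr_gt0 divr_gt0// exprn_gt0.
have := @expR_ge1Dxn R x 3 (ltW x0); rewrite invf_div.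
by apply: le_trans; rewrite (_ : 4`! = 24)%N// lerDr.
Qed.

(** Exponential decay is traded for a fourth power, which scales simply in both [s] and [2^i]. *)
Lemma geometric_le_quartic rho : 0 <= rho < 1 ->
  (* The proof replaces [rho] by [q >= 1/2] because [rho] may be 0, where the logarithm is
     useless. *)
  exists2 K : R, 0 < K & forall n, rho ^+ n <= K / n.+1%:R ^+ 4.
Proof.
move=> /andP[r0 r1]; pose q := Num.max rho 2^-1.
have q0 : 0 < q by rewrite lt_max invr_gt0 ltr0n orbT.
have q1 : q < 1 by rewrite gt_max r1 invf_lt1// ltr1n.
pose l := - ln q.
have l0 : 0 < l by rewrite oppr_gt0 ln_lt0// q0.
exists (24 / l ^+ 4 / q); first by rewrite !divr_gt0 ?exprn_gt0.
move=> n; apply: (@le_trans _ _ (q ^+ n)).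
  by rewrite lerXn2r ?nnegrE// ?(ltW q0)// le_max lexx.
have -> : q ^+ n = expR (- (l * n.+1%:R)) / q.
  rewrite mulNr opprK expRM_natr lnK ?posrE// exprSr mulfK//.
  by rewrite gt_eqF.
rewrite -[leRHS]mulrAC ler_pM2r ?invr_gt0//.
apply: le_trans (expRN_le_quartic _ _) _; first by rewrite mulr_gt0.
by rewrite exprMn invfM mulrA.
Qed.

Lemma sum_inv_square n : \sum_(j < n) (j.+1%:R ^+ 2)^-1 <= 2 :> R.
Proof.
suff h : (0 < n)%N -> \sum_(j < n) (j.+1%:R ^+ 2)^-1 <= 2 - n%:R^-1 :> R.
  case: n h => [_|n h]; first by rewrite big_ord0.
  by apply: le_trans (h isT) _; rewrite lerBlDr lerDl invr_ge0.
elim: n => // -[_ _|n IH _]; first by rewrite big_ord_recr big_ord0/= expr1n invr1; lra.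
rewrite big_ord_recr/=; apply: (le_trans (lerD (IH isT) (lexx _))).
have n0 : (0 : R) < n.+1%:R by rewrite ltr0n.
have -> : n.+2%:R = n.+1%:R + 1 :> R by rewrite natr1.
move: n0; set x := n.+1%:R => x0.
(* Exact gap in the telescoping comparison of [1 / (x + 1)^2] with [1 / x - 1 / (x + 1)]. *)
rewrite -subr_ge0 (_ : _ - _ = (x * (x + 1) ^+ 2)^-1).
  by rewrite invr_ge0 mulr_ge0 ?exprn_ge0//; lra.
by field; rewrite gt_eqF//= gt_eqF//; lra.
Qed.

Lemma count_le_ratio c x n : 0 < c -> 0 <= x ->
  \sum_(j < n) (j.+1%:R * c < x)%R%:R <= x / c.
Proof.
move=> c0 x0; elim: n => [|n IH]; first by rewrite big_ord0 divr_ge0// ltW.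
rewrite big_ord_recr/=; case: ltP => [h|_]; last by rewrite addr0.
apply: (@le_trans _ _ n.+1%:R); last by rewrite ler_pdivlMr// ltW.
rewrite -natr1 lerD//; apply: (@le_trans _ _ (\sum_(j < n) 1)).
  by apply: ler_sum => j _; case: (_ < _).
by rewrite sumr_const card_ord.
Qed.

(** Of the [N + 3] powers of the maximum, [N + 1] are bounded through [r]; the other two, through
    [(j + 1) c / 2], make the sum over [j] converge. *)
Lemma sum_power_tail (r c : R) (N n : nat) : 0 < c -> c <= 1 -> 1 <= r ->
  \sum_(j < n) (Num.max r (j%:R * c) ^+ (N.+1 + 2))^-1 <= 8 / c ^+ 2 / r ^+ N.+1.
Proof.
move=> c0 c1 r1; have r0 : 0 < r by lra.
apply: (@le_trans _ _ (\sum_(j < n) 4 / c ^+ 2 / r ^+ N.+1 * (j.+1%:R ^+ 2)^-1)).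
  apply: ler_sum => j _; set m := Num.max _ _.
  have rm : r <= m by rewrite le_max lexx.
  have jm : j.+1%:R * c / 2 <= m.
    have : j%:R * c <= m by rewrite le_max lexx orbT.
    rewrite -natr1; lra.
  have m0 : 0 < m by lra.
  rewrite exprD invfM [X in _ <= X * _]mulrC -mulrA ler_pM//.
  - by rewrite invr_ge0 exprn_ge0// ltW.
  - by rewrite invr_ge0 exprn_ge0// ltW.
  - by rewrite lef_pV2 ?posrE ?exprn_gt0// lerXn2r ?nnegrE// ltW.
  have -> : 4 / c ^+ 2 * (j.+1%:R ^+ 2)^-1 = ((j.+1%:R * c / 2) ^+ 2)^-1.
    by field; rewrite gt_eqF//= pnatr_eq0.
  have j0 : 0 < j.+1%:R * c / 2 by rewrite divr_gt0// mulr_gt0.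
  by rewrite lef_pV2 ?posrE ?exprn_gt0// lerXn2r ?nnegrE// ltW.
rewrite -mulr_sumr.
have := sum_inv_square n; set S := \sum_(_ < _) _ => S2.
apply: (@le_trans _ _ (4 / c ^+ 2 / r ^+ N.+1 * 2)).
  by rewrite ler_wpM2l// !divr_ge0// exprn_ge0// ltW.
lra.
Qed.

End real_bounds.

(** * Moments and tail sums of a service time *)

Section moments.
Context {d : measure_display} {Omega : measurableType d} {R : realType}.
Variables (P : probability Omega R) (V : Omega -> R).
Hypotheses (mV : measurable_fun setT V).

Lemma tail_measurable y : measurable [set w | y < V w].
Proof. exact: measurable_set_lt. Qed.

Lemma moment_tail (q : nat) (y : R) :
  P.-integrable setT (fun w => (V w `^ q%:R)%:E) -> 0 < y ->
  (P [set w | (y < V w)%R] <=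
   (fine (\int[P]_w (V w `^ q%:R)%:E) / y ^+ q)%:E)%E.
Proof.
move=> iV y0; have fV := integrable_fin_num measurableT iV.
rewrite mulrC EFinM lee_pdivlMl ?exprn_gt0// fineK//.
rewrite -[[set w | _]]setIT -integral_indic//; last exact: tail_measurable.
rewrite -ge0_integralZl//; first last.
- by rewrite lee_fin exprn_ge0// ltW.
- apply/measurable_EFinP; apply: measurable_indic; exact: tail_measurable.
apply: ge0_le_integral => //.
- by move=> w _; rewrite mule_ge0 ?lee_fin// exprn_ge0// ltW.
- apply/measurable_EFinP; apply: measurable_funM => //.
  by apply: measurable_indic; exact: tail_measurable.
- by have /integrableP[] := iV.
- move=> w _; rewrite -EFinM lee_fin indicE.
  have [yV|yV] := pselect (y < V w).
    have Vw0 : 0 < V w by apply: lt_trans yV.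
    rewrite mem_set// mulr1 -powR_mulrn ?(ltW y0)//.
    by apply: (@ge0_ler_powR _ q%:R _ y (V w)); rewrite ?nnegrE ?(ltW y0) ?(ltW Vw0) ?(ltW yV).
  by rewrite memNset// mulr0 powR_ge0.
Qed.

Hypotheses (V0 : P [set w | 0 <= V w] = 1%E) (iV : P.-integrable setT (EFin \o V)).

Lemma ae_nonneg : \forall w \ae P, 0 <= V w.
Proof.
have mA : measurable [set w | 0 <= V w] by exact: measurable_set_le.
exists (~` [set w | 0 <= V w]); split=> //; first exact: measurableC.
transitivity (1 - P [set w | (0 <= V w)%R])%E; last by rewrite V0 subee.
exact: probability_setC.
Qed.

Lemma expectation_pos : (\int[P]_w (Num.max (V w) 0)%:E = 'E_P[V])%E.
Proof.
rewrite unlock; apply: ae_eq_integral => //.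
- by apply/measurable_EFinP; apply: measurable_maxr.
- exact/measurable_EFinP.
- by apply: filterS ae_nonneg => w h _; rewrite max_l.
Qed.

Lemma fine_expectation_ge0 : 0 <= fine 'E_P[V]%E.
Proof.
rewrite -expectation_pos fine_ge0// integral_ge0// => w _.
by rewrite lee_fin le_max lexx orbT.
Qed.

(** The terms with [j >= 1] add up to the mean number of positive multiples of [c] below [V], at
    most [E V / c]; the term [j = 0] costs the 1. *)
Lemma sum_tail_le (c : R) (n : nat) : 0 < c ->
  \sum_(j < n) fine (P [set w | j%:R * c < V w]) <= 1 + fine 'E_P[V]%E / c.
Proof.
move=> c0; case: n => [|n].
  by rewrite big_ord0 addr_ge0// divr_ge0 ?fine_expectation_ge0// ltW.
rewrite big_ord_recl/= lerD//.
  by rewrite -lee_fin fineK ?fin_num_measure ?probability_le1//; exact: tail_measurable.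
have fE : 'E_P[V]%E \is a fin_num by rewrite unlock; exact: integrable_fin_num.
rewrite -lee_fin -sumEFin mulrC EFinM fineK//.
rewrite (eq_bigr (fun j : 'I_n => \int[P]_w (\1_([set w | j.+1%:R * c < V w]) w)%:E)%E); last first.
  move=> j _; rewrite fineK; last by apply: fin_num_measure; exact: tail_measurable.
  by rewrite integral_indic// ?setIT//; exact: tail_measurable.
rewrite -ge0_integral_sum//; last first.
  move=> j; apply/measurable_EFinP; apply: measurable_indic; exact: tail_measurable.
rewrite -expectation_pos -ge0_integralZl//; first last.
- by rewrite lee_fin invr_ge0 ltW.
- by move=> w _; rewrite lee_fin le_max lexx orbT.
- by apply/measurable_EFinP; apply: measurable_maxr.
apply: ge0_le_integral => //.
- by move=> w _; apply: sume_ge0 => j _; rewrite lee_fin.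
- apply: emeasurable_sum => j; apply/measurable_EFinP; apply: measurable_indic.
  exact: tail_measurable.
- apply/measurable_EFinP; apply: measurable_funM => //; exact: measurable_maxr.
- move=> w _; rewrite sumEFin -EFinM lee_fin mulrC.
  apply: le_trans (count_le_ratio _ (Num.max (V w) 0) n c0 _); last by rewrite le_max lexx orbT.
  apply: ler_sum => j _; rewrite indicE.
  have [yV|yV] := pselect (j.+1%:R * c < V w).
    by rewrite mem_set// lt_max yV.
  by rewrite memNset.
Qed.

End moments.

(** * Probabilities of the three overload events, uniform in the starting index *)

Section streams.
Context {d : measure_display} {Omega : measurableType d} {R : realType}.
Variable P : probability Omega R.

(** Independence is not stated here: it comes from [mutual_indep P D F] through the injection
    [e]. *)
Definition iid_stream (I : choiceType) (D : set I) (F : I -> set_system Omega)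
  (e : nat -> I) (Y : nat -> Omega -> R) (Y0 : Omega -> R) : Prop :=
  [/\ injective e, (forall n, D (e n)),
      (forall n (B : set R), measurable B -> F (e n) (Y n @^-1` B)) &
      forall n, same_law P (Y n) Y0].

Definition pos_part (g : nat -> Omega -> R) n w := Num.max (g n w) 0.

Variables (X0 V0 : Omega -> R).
Hypotheses (mX : measurable_fun setT X0) (mV : measurable_fun setT V0)
  (X00 : P [set w | 0 <= X0 w] = 1%E) (V00 : P [set w | 0 <= V0 w] = 1%E)
  (iV : forall q : R, 0 < q -> P.-integrable setT (fun w => (V0 w `^ q)%:E)).

(** Multiplying the gaps by [s] restores the law of [X0], so the geometric rate, and with it [K],
    does not depend on [s]. Summing the rate over all lengths from [n] on keeps the decay. *)
Lemma slow_le (mu : R) : 0 < mu -> (mu%:E < 'E_P[X0])%E ->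
  exists2 K : R, 0 < K & forall (s : nat) (I : choiceType) (D : set I)
    (F : I -> set_system Omega) e g, (0 < s)%N ->
    (forall i, F i `<=` measurable) -> mutual_indep P D F ->
    iid_stream I D F e g (fun w => X0 w / s%:R) ->
    forall n k, (P (slow (pos_part g) xpredT (mu / s%:R) n k) <= (K / n.+1%:R ^+ 4)%:E)%E.
Proof.
move=> mu0; rewrite -(expectation_pos P X0 mX X00) => muX.
pose X' : {RV P >-> R} := mfun_Sub (mem_set mX).
have [|rho [rho01 rhoP]] := @renewal_rate R (distribution P X') mu.
  rewrite ge0_integral_distribution//.
  - by apply/measurable_EFinP; apply: measurable_maxr.
  - by move=> y; rewrite lee_fin le_max lexx orbT.
have [K K0 KP] := geometric_le_quartic rho rho01.
have [r0 r1] : 0 <= rho /\ rho < 1 by apply/andP.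
exists (K / (1 - rho)); first by rewrite divr_gt0// subr_gt0.
move=> s I D F e g s0 Fm indP [einj eD Fg lawg] n k.
have sR0 : 0 < s%:R :> R by rewrite ltr0n.
have mg i : measurable_fun setT (g i).
  by move=> _ B mB; rewrite setTI; apply: Fm (Fg i B mB).
pose E j := [set w | \sum_(i < n + j) s%:R * pos_part g (k + i) w < (n + j)%:R * mu].
have sumE j w : \sum_(i < j) s%:R * pos_part g (k + i) w =
    \sum_(i < j) Num.max (s%:R * g (k + i)%N w) 0.
  by apply: eq_bigr => i _; rewrite /pos_part maxr_pMr ?mulr0// ltW.
have mE j : measurable (E j).
  apply: measurable_set_lt => //; apply: measurable_sum => i.
  by apply: measurable_funM => //; apply: measurable_maxr.
have -> : slow (pos_part g) xpredT (mu / s%:R) n k = \bigcup_j E j.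
  have cmp j w : (\sum_(i < j) pos_part g (k + i) w < j%:R * (mu / s%:R)) =
      (\sum_(i < j) s%:R * pos_part g (k + i) w < j%:R * mu).
    by rewrite -mulr_sumr mulrA ltr_pdivlMr// mulrC.
  apply/seteqP; split=> w.
    by move=> [j [nj _]]; rewrite cmp => h; exists (j - n)%N; rewrite //= /E/= subnKC.
  by move=> [j _]; rewrite /E /= -cmp => h; exists (n + j)%N; split=> //; exact: leq_addr.
apply: (bigcup_le P E (fun j => rho ^+ (n + j))) => //.
  move=> j; rewrite /E.
  under eq_set do rewrite sumE.
  apply: (rhoP _ _ P I D F (n + j)%N (fun i => e (k + i)%N) (fun i w => s%:R * g (k + i)%N w)) => //.
    by move=> a b /einj /addnI /val_inj.
  move=> i B mB.
  have mB' : measurable ((fun x : R => s%:R * x) @^-1` B).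
    rewrite -[X in measurable X]setTI.
    have ms : measurable_fun setT (fun x : R => s%:R * x) by exact: measurable_funM.
    exact: ms.
  split; first exact: (Fg (k + i)%N _ mB').
  rewrite (lawg (k + i)%N _ mB') /distribution /pushforward /=; congr (P _).
  by apply/seteqP; split=> w /=; rewrite mulrC divfK// gt_eqF.
move=> m; apply: le_trans (geometric_tail _ _ _ rho01) _.
by rewrite [leRHS]mulrAC ler_pM2r ?invr_gt0 ?subr_gt0.
Qed.

(** Markov's inequality with the moment of order [N + 3]; the factor [s^2] is [1 / c^2] for
    [c = mu / s]. *)
Lemma long_le (mu : R) (N : nat) : 0 < mu ->
  exists2 K : R, 0 < K & forall (s : nat) (I : choiceType) (D : set I)
    (F : I -> set_system Omega) e v, (0 < s)%N -> mu <= s%:R ->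
    (forall i, F i `<=` measurable) -> iid_stream I D F e v V0 ->
    forall r k, 1 <= r ->
    (P (long v xpredT (mu / s%:R) r k) <= (K * s%:R ^+ 2 / r ^+ N.+1)%:E)%E.
Proof.
move=> mu0; pose m := fine (\int[P]_w (V0 w `^ (N.+1 + 2)%:R)%:E)%E.
have m0 : 0 <= m by rewrite fine_ge0// integral_ge0// => w _; rewrite lee_fin powR_ge0.
exists ((m + 1) * 8 / mu ^+ 2); first by rewrite divr_gt0 ?exprn_gt0//; lra.
move=> s I D F e v s0 mus Fm [einj eD Fv lawv] r k r1.
have sR0 : 0 < s%:R :> R by rewrite ltr0n.
have mv i : measurable_fun setT (v i).
  by move=> _ B mB; rewrite setTI; apply: Fm (Fv i B mB).
have r0 : 0 < r by lra.
pose E j := [set w | Num.max r (j%:R * (mu / s%:R)) < v (k + j)%N w].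
have -> : long v xpredT (mu / s%:R) r k = \bigcup_j E j.
  by apply/seteqP; split=> w; [move=> [j [_ h]]; exists j|move=> [j _ h]; exists j].
apply: (bigcup_le P E (fun j => m * (Num.max r (j%:R * (mu / s%:R)) ^+ (N.+1 + 2))^-1)).
- by move=> j; exact: measurable_set_lt.
- move=> j; have mB : measurable (`]Num.max r (j%:R * (mu / s%:R)), +oo[ : set R)%classic by [].
  have EE (f : Omega -> R) : f @^-1` `]Num.max r (j%:R * (mu / s%:R)), +oo[ =
      [set w | Num.max r (j%:R * (mu / s%:R)) < f w].
    by apply/seteqP; split=> w; rewrite /= in_itv/= andbT.
  have PE := lawv (k + j)%N _ mB; rewrite !EE in PE.
  have h : (P (E j) <= (m * (Num.max r (j%:R * (mu / s%:R)) ^+ (N.+1 + 2))^-1)%:E)%E.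
    rewrite PE; apply: moment_tail => //; first by apply: iV; rewrite ltr0n.
    by rewrite lt_max r0.
  exact: h.
- move=> n; rewrite -mulr_sumr.
  have c0 : 0 < mu / s%:R by rewrite divr_gt0.
  have c1 : mu / s%:R <= 1 by rewrite ler_pdivrMr// mul1r.
  apply: le_trans (ler_wpM2l m0 (sum_power_tail _ _ N n c0 c1 r1)) _.
  rewrite mulrA ler_pM2r ?invr_gt0 ?exprn_gt0//.
  pose X := 8 * s%:R ^+ 2 / mu ^+ 2.
  have -> : m * (8 / (mu / s%:R) ^+ 2) = m * X.
    by rewrite /X; field; rewrite !gt_eqF.
  have -> : (m + 1) * 8 / mu ^+ 2 * s%:R ^+ 2 = (m + 1) * X.
    by rewrite /X; field; rewrite gt_eqF.
  by rewrite ler_pM2r ?lerDl// divr_gt0 ?exprn_gt0// mulr_gt0 ?exprn_gt0.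
Qed.

(** Whatever [M] is, the mean count is at most [1 + s a] with [a = E V / mu], so exceeding [s zeta]
    is exponentially unlikely in [s]. *)
Lemma crowd_le (mu zeta : R) : 0 < mu -> fine 'E_P[V0]%E / mu < zeta ->
  exists2 K : R, 0 < K & forall (s : nat) (I : choiceType) (D : set I)
    (F : I -> set_system Omega) e v, (0 < s)%N ->
    (forall i, F i `<=` measurable) -> mutual_indep P D F -> iid_stream I D F e v V0 ->
    forall M k, (P (crowd v xpredT (mu / s%:R) M (s%:R * zeta) k) <= (K / s%:R ^+ 4)%:E)%E.
Proof.
move=> mu0; set a := _ / mu => az.
have iV1 : P.-integrable setT (EFin \o V0).
  apply/integrableP; split; first exact/measurable_EFinP.
  have /integrableP[mV1] := iV 1 ltr01.
  rewrite (_ : (\int[P]_w `|(V0 w `^ 1)%:E| = \int[P]_w `|(EFin \o V0) w|)%E)//.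
  apply: ae_eq_integral => //.
  - exact: measurableT_comp.
  - by apply: measurableT_comp => //; exact/measurable_EFinP.
  - by apply: filterS (ae_nonneg P V0 mV V00) => w w0 _; rewrite powRr1.
have a0 : 0 <= a by rewrite divr_ge0 ?(ltW mu0)//; exact: (fine_expectation_ge0 P V0 mV V00).
(* Then [t + 2 t^2 <= 1] bounds the part of the exponent free of [s], and
   [2 t^2 a <= t (zeta - a) / 2] leaves half of the drift, which is [kap]. *)
pose t := Num.min (2^-1) ((zeta - a) / (4 * (a + 1))).
have t0 : 0 < t by rewrite lt_min invr_gt0 ltr0n/= divr_gt0 ?subr_gt0//; lra.
have t1 : t <= 2^-1 by rewrite ge_min lexx.
have ta : 4 * t * (a + 1) <= zeta - a.
  have : t <= (zeta - a) / (4 * (a + 1)) by rewrite ge_min lexx orbT.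
  by rewrite ler_pdivlMr; nra.
pose kap := t * (zeta - a) / 2.
have kap0 : 0 < kap by rewrite !mulr_gt0 ?subr_gt0// invr_gt0.
exists (expR 1 * 24 / kap ^+ 4); first by rewrite divr_gt0 ?exprn_gt0// mulr_gt0 ?expR_gt0.
move=> s I D F e v s0 Fm indP [einj eD Fv lawv] M k.
have sR0 : 0 < s%:R :> R by rewrite ltr0n.
have c0 : 0 < mu / s%:R by rewrite divr_gt0.
pose U (i : 'I_M) := [set w | i%:R * (mu / s%:R) < v (k + i)%N w].
have EE (f : Omega -> R) i : f @^-1` `]i%:R * (mu / s%:R), +oo[ = [set w | i%:R * (mu / s%:R) < f w].
  by apply/seteqP; split=> w; rewrite /= in_itv/= andbT.
have -> : crowd v xpredT (mu / s%:R) M (s%:R * zeta) k = [set w | s%:R * zeta < \sum_i \1_(U i) w].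
  have sE w : \sum_(j < M) (j%:R * (mu / s%:R) < v (k + j)%N w)%R%:R = \sum_i \1_(U i) w :> R.
    apply: eq_bigr => i _; rewrite indicE; congr (_%:R).
    by case: (boolP (_ < _)) => h; [rewrite mem_set|rewrite memNset//; apply/negP].
  by apply/seteqP; split=> w; rewrite /crowd/= sE.
have := @count_tail _ _ _ P I D F M (fun i => e (k + i)%N) Fm indP _ _ U
   (1 + s%:R * a) (s%:R * zeta) t _ _ _.
move=> H; apply: le_trans (H _ _ _ _ _) _.
- by move=> i j /einj /addnI /val_inj.
- by move=> i; exact: eD.
- move=> i; rewrite /U -EE; split; first exact: Fv.
  by rewrite preimage_setC; apply: Fv; exact: measurableC.
- by rewrite ltW.
- rewrite (eq_bigr (fun i : 'I_M => fine (P [set w | i%:R * (mu / s%:R) < V0 w]))).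
    apply: le_trans (sum_tail_le P V0 mV V00 iV1 _ _ c0) _.
    rewrite lerD2l (_ : _ / (mu / s%:R) = s%:R * a)//; rewrite /a.
    by field; rewrite !gt_eqF.
  by move=> i _; rewrite /U -EE lawv// EE.
rewrite lee_fin; apply: (@le_trans _ _ (expR 1 * expR (- (kap * s%:R)))).
  rewrite -expRD ler_expR /kap.
  have h1 : t * (a + 1) * (t * s%:R) * 4 <= (zeta - a) * (t * s%:R).
    by rewrite mulrAC ler_pM2r; nra.
  have h2 : 0 <= t * t * s%:R by rewrite !mulr_ge0// ltW.
  nra.
have := expRN_le_quartic (kap * s%:R); rewrite mulr_gt0// => /(_ isT) h.
apply: le_trans (ler_wpM2l (expR_ge0 _) h) _.
by rewrite exprMn invfM !mulrA.
Qed.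
End streams.

(** * Backward indexing, and what a good window says about [tau'] *)

Section backward.
Context {d : measure_display} {Omega : measurableType d} {R : realType} {L : nat}.
Variables (T V : 'I_L -> int -> Omega -> R).

(* Index [n : nat] stands for the job [- n : int]; [Negz n] is [- (n + 1)]. *)
Definition back_age l (n : nat) w : R := - T l (- n%:Z) w.
Definition back_gap l (n : nat) w : R := T l (- n%:Z) w - T l (Negz n) w.
Definition back_service l (n : nat) : Omega -> R := V l (- n%:Z).

Lemma back_gapE l n : back_gap l n = gap T l (Negz n).
Proof.
apply/funext => w; rewrite /back_gap /gap; congr (T l _ w - _).
by rewrite NegzE -addn1 PoszD opprD addrNK.
Qed.

Lemma back_ageS l n w : back_age l n.+1 w = back_age l n w + back_gap l n w.
Proof. by rewrite /back_age /back_gap NegzE; lra. Qed.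

(** Properties that hold outside a null set. The second keeps jobs of positive index out of negative
    times; the third makes every first passage exist. *)
Definition regular (w : Omega) : Prop :=
  [/\ forall l n, 0 <= back_gap l n w, forall l (n : nat), 0 < T l n.+1%:Z w &
      forall l (y : R), exists n, y <= back_age l n w].

End backward.

Section window.
Context {d : measure_display} {Omega : measurableType d} {R : realType} {J L : nat}.
Variables (Pm : 'I_L -> 'I_J -> bool) (C : 'I_J -> nat) (s : nat)
  (T V : 'I_L -> int -> Omega -> R).
Variables (c z : 'I_L -> R) (M n1 : 'I_L -> nat) (n0 : nat) (y r wd y' : R)
  (a b : 'I_L -> nat) (w : Omega).
Hypotheses (r0 : 0 < r) (y0 : 0 < y) (wd0 : 0 <= wd) (c0 : forall l, 0 < c l)
  (z0 : forall l, 0 <= z l) (yy' : y + r + wd <= y')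
  (Mr : forall l, r <= (M l)%:R * c l) (n0r : forall l, n0%:R * c l <= r)
  (n1w : forall l, (n1 l)%:R * c l <= wd)
  (capacity : forall j, \sum_(l < L | Pm l j) (n0%:R + z l) <= (s * C j)%:R)
  (regw : regular T w)
  (ya : forall l, first_passage (back_age T l ^~ w) y (a l))
  (yb : forall l, first_passage (back_age T l ^~ w) y' (b l))
  (notoverload : forall l m, (m <= M l)%N ->
    ~ overload (pos_part (back_gap T l)) (back_service V l)
       (fun i => i < b l)%N (c l) n0 (M l) r (z l) (a l + m) w)
  (notslow : forall l, ~ slow (pos_part (back_gap T l)) xpredT (c l) (n1 l) (b l) w)
  (notlong : forall l, ~ long (back_service V l) xpredT (c l) wd (b l) w).

Let stepE l n : back_age T l n.+1 w = back_age T l n w + pos_part (back_gap T l) n w.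
Proof.
by have [g0 _ _] := regw; rewrite back_ageS /pos_part max_l.
Qed.

Let pos_ge0 l n : 0 <= pos_part (back_gap T l) n w.
Proof. by rewrite le_max lexx orbT. Qed.

Lemma window_remaining l n : y + r <= back_age T l n w ->
  back_service V l n w <= back_age T l n w - y.
Proof.
apply: (remaining_service (back_age T l ^~ w) (pos_part (back_gap T l) ^~ w)
  (back_service V l ^~ w) (stepE l) (pos_ge0 l) y r wd y' (c l) (a l) (b l) (M l) n0 (n1 l)) => //.
- exact: ltW.
- move=> m j mM nj ajb; rewrite leNgt; apply/negP => h.
  by apply: (notoverload l m mM); left; left; exists j.
- move=> m j mM ajb; rewrite leNgt; apply/negP => h.
  by apply: (notoverload l m mM); left; right; exists j.
- move=> j nj; rewrite leNgt; apply/negP => h.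
  by apply: (notslow l); exists j.
- move=> j; rewrite leNgt; apply/negP => h.
  by apply: (notlong l); exists j.
Qed.

Lemma window_count l u (ns : seq nat) : y <= u <= y + r -> uniq ns ->
  (forall n, n \in ns -> u <= back_age T l n w /\ back_age T l n w - u < back_service V l n w) ->
  (size ns)%:R <= n0%:R + z l.
Proof.
apply: (window_load (back_age T l ^~ w) (pos_part (back_gap T l) ^~ w)
  (back_service V l ^~ w) (stepE l) (pos_ge0 l) y r wd y' (c l) (z l) (a l) (b l) (M l) n0 (n1 l)) => //.
- exact: ltW.
- move=> m j mM nj ajb; rewrite leNgt; apply/negP => h.
  by apply: (notoverload l m mM); left; left; exists j.
- move=> m j mM ajb; rewrite leNgt; apply/negP => h.
  by apply: (notoverload l m mM); left; right; exists j.
- move=> m mM; rewrite leNgt; apply/negP => h.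
  by apply: (notoverload l m mM); right.
- move=> j nj; rewrite leNgt; apply/negP => h.
  by apply: (notslow l); exists j.
- move=> j; rewrite leNgt; apply/negP => h.
  by apply: (notlong l); exists j.
Qed.

Lemma present_back u l (n : int) : u < 0 -> present T V w u (l, n) ->
  n = - `|n|%N%:Z /\ - u <= back_age T l `|n|%N w /\
  back_age T l `|n|%N w - - u < back_service V l `|n|%N w.
Proof.
move=> u0 /=; have [_ Tpos _] := regw.
have [[m nm]|[m nm]] : (exists m, n = - m%:Z) \/ (exists m : nat, n = m.+1%:Z).
- case: n => [[|m]|m]; [by left; exists 0%N|by right; exists m|by left; exists m.+1].
- rewrite nm abszN absz_nat /back_age /back_service => /andP[h1 h2].
  by split=> //; split; lra.
- by rewrite nm => /andP[h1 _]; have := Tpos l m; lra.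
Qed.

Lemma Rmax_window : (Rmax T V w (- (y + r))%R <= r%:E)%E.
Proof.
have [h1 h2] := conj y0 r0.
apply: ge_ereal_sup => _ [[[l n] pln <-]|->]; last by rewrite lee_fin ltW.
have x0 : - (y + r) < 0 by lra.
have [nE [+ _]] := present_back _ _ _ x0 pln.
rewrite opprK => /window_remaining.
rewrite /= {3 4}nE lee_fin /back_age /back_service; lra.
Qed.

Lemma Q_window (j : 'I_J) (u : R) : - (y + r) <= u <= - y -> Q_le Pm T V w j u (s * C j).
Proof.
move=> /andP[u1 u2] js ujs jsP; have [h1 h2] := conj y0 r0.
have u0 : u < 0 by lra.
pose ns l := [seq `|ln.2|%N | ln <- js & ln.1 == l].
have nsP l : (size (ns l))%:R <= n0%:R + z l.
  apply: (window_count l (- u)); first by apply/andP; split; lra.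
    (* [absz] is injective on these jobs, since a job present at a negative time has a nonpositive
       index. *)
    rewrite map_inj_in_uniq ?filter_uniq// => -[l1 i1] [l2 i2].
    rewrite !mem_filter/= => /andP[/eqP -> i1s] /andP[/eqP -> i2s] i12.
    have [_ /(present_back _ _ _ u0)[e1 _]] := jsP _ i1s.
    have [_ /(present_back _ _ _ u0)[e2 _]] := jsP _ i2s.
    by rewrite e1 e2 i12.
  move=> _ /mapP[[l1 i] + ->]; rewrite mem_filter/= => /andP[/eqP -> iS].
  by have [_ /(present_back _ _ _ u0)[_]] := jsP _ iS.
rewrite -(ler_nat R); apply: le_trans (capacity j).
rewrite -sum1_size big_seq (partition_big (fun ln => ln.1) (fun l => Pm l j))/=; last first.
  by move=> ln /jsP[].
rewrite natr_sum; apply: ler_sum => l _.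
rewrite -big_seq_cond sum1_count -size_filter -(size_map (fun ln => `|ln.2|%N)); exact: nsP.
Qed.

(** The time [-(y + r)] is admissible in the supremum: the remaining service there is at most [r],
    so the interval to be checked stays inside [[-(y + r), -y]]. *)
Lemma window_tau' : (`| tau' Pm C s T V w | <= (y + r)%:E)%E.
Proof.
have [h1 h2] := conj y0 r0.
have Rm := Rmax_window.
have R0 : (0 <= Rmax T V w (- (y + r))%R)%E by apply: ereal_sup_ubound; right.
have fR : fine (Rmax T V w (- (y + r))) <= r.
  by rewrite -lee_fin fineK// fin_real// (lt_le_trans _ R0)// (le_lt_trans Rm)// ltry.
rewrite /tau'; set S := [set _ | _ in _].
have S0 : (ereal_sup S <= 0)%E.
  by apply: ge_ereal_sup => _ [t [t0 _] <-]; rewrite lee_fin ltW.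
have Sx : ((- (y + r))%:E <= ereal_sup S)%E.
  apply: ereal_sup_ubound; exists (- (y + r)) => //; split; first by lra.
  split.
    apply: le_trans Rm _; rewrite lee_fin normrN ger0_norm; lra.
  move=> j u /andP[u1 u2]; apply: Q_window; apply/andP; split=> //.
  by apply: le_trans u2 _; lra.
by rewrite lee0_abs// leeNl.
Qed.

End window.

(** * Measurability under countable quantifiers *)

Section measurability.
Context {d : measure_display} {T : measurableType d}.

Lemma measurable_exists (B : countType) (Q : B -> set T) :
  (forall b, measurable (Q b)) -> measurable [set w | exists b, Q b w].
Proof.
move=> mQ; rewrite (_ : [set w | _] = \bigcup_b Q b).
  exact: bigcup_countType_measurable.
by apply/seteqP; split=> w; [move=> [b Qb]; exists b|move=> [b _ Qb]; exists b].
Qed.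

Lemma measurable_forall (B : countType) (Q : B -> set T) :
  (forall b, measurable (Q b)) -> measurable [set w | forall b, Q b w].
Proof.
move=> mQ; rewrite (_ : [set w | _] = ~` [set w | exists b, (~` Q b) w]).
  by apply: measurableC; apply: measurable_exists => b; exact: measurableC.
apply/seteqP; split=> w /=; first by move=> h [b]; apply; exact: h.
by move=> h b; apply: contrapT => nQ; apply: h; exists b.
Qed.

Lemma measurable_imply (A : Prop) (Q : set T) :
  (A -> measurable Q) -> measurable [set w | A -> Q w].
Proof.
move=> mQ; have [a|na] := pselect A.
  by rewrite (_ : [set w | _] = Q); [exact: mQ|apply/seteqP; split=> w /= h; [exact: h a|move=> _; exact: h]].
rewrite (_ : [set w | _] = setT); first exact: measurableT.
by apply/seteqP; split=> w //= _ /na.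
Qed.

Lemma measurable_and_const (A : Prop) (Q : set T) :
  (A -> measurable Q) -> measurable [set w | A /\ Q w].
Proof.
move=> mQ; have [a|na] := pselect A.
  by rewrite (_ : [set w | _] = Q); [exact: mQ|apply/seteqP; split=> w /= h; [case: h|split]].
rewrite (_ : [set w | _] = set0); first exact: measurable0.
by apply/seteqP; split=> w //= -[/na].
Qed.

End measurability.

(** * Sigma-algebras of the stationary input, read backwards *)

Section stationary.
Context {d : measure_display} {Omega : measurableType d} {R : realType} {L : nat}.
Variables (P : probability Omega R) (X0 V0 : 'I_L -> Omega -> R) (s : nat)
  (T V : 'I_L -> int -> Omega -> R).
Hypothesis inp : stationary_input P X0 V0 s T V.

Definition input_dom : set (idx L) :=
  [set i : idx L | match i with inl (inr (_, n)) => n != 0%R | _ => True end].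

Definition input_events (i : idx L) : set_system Omega :=
  match i with
  | inl (inl l) => rv2_events (fun w => - T l 0%R w)%R (T l 1%R)
  | inl (inr (l, n)) => rv_events (gap T l n)
  | inr (l, n) => rv_events (V l n)
  end.

(** The past consists of the jobs nearest to time 0. Gap [m] joins jobs [m] and [m + 1], so the gaps
    below [b l] fix the ages up to and including [b l], while the service time of job [b l] itself
    stays in the future. *)
Definition past_idx (b : {ffun 'I_L -> nat}) : set (idx L) :=
  [set i : idx L | match i with
    | inl (inl _) => True
    | inl (inr (l, n)) => exists m : nat, (m < b l)%N /\ n = Negz m
    | inr (l, n) => exists m : nat, (m < b l)%N /\ n = - m%:Z
    end].

Definition fut_idx (b : {ffun 'I_L -> nat}) : set (idx L) :=
  [set i : idx L | match i with
    | inl (inl _) => False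
    | inl (inr (l, n)) => exists m : nat, (b l <= m)%N /\ n = Negz m
    | inr (l, n) => exists m : nat, (b l <= m)%N /\ n = - m%:Z
    end].

Definition past b : set_system Omega := <<s gens _ input_events (past_idx b)>>.
Definition fut b : set_system Omega := <<s gens _ input_events (fut_idx b)>>.

Let mT l n : measurable_fun setT (T l n).
Proof. by case: inp => -[mT _] _ _ _ _; exact: mT. Qed.

Let mV l n : measurable_fun setT (V l n).
Proof. by case: inp => -[_ mV] _ _ _ _; exact: mV. Qed.

Lemma input_indep : mutual_indep P input_dom input_events.
Proof. by case: inp. Qed.

Lemma input_measurable i : input_events i `<=` measurable.
Proof.
case: i => [[l|[l n]]|[l n]] A [B mB ->]; rewrite -[X in measurable X]setTI.
- have mp : measurable_fun setT (fun w => (- T l 0 w, T l 1 w)).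
    by apply: measurable_fun_pair => //; exact: measurableT_comp.
  exact: mp.
- have mg : measurable_fun setT (gap T l n) by apply: measurable_funB.
  exact: mg.
- exact: mV.
Qed.

Lemma input_eventsT i : input_events i setT.
Proof. by case: i => [[l|[l n]]|[l n]]; exists setT. Qed.

Lemma input_eventsI i : setI_closed (input_events i).
Proof.
by case: i => [[l|[l n]]|[l n]] _ _ [A mA ->] [B mB ->]; exists (A `&` B) => //;
  exact: measurableI.
Qed.

Lemma gens_measurable (S : set (idx L)) : <<s gens _ input_events S>> `<=` measurable.
Proof.
apply: smallest_sub; first exact: sigma_algebra_measurable.
by move=> A [i _]; exact: input_measurable.
Qed.

Lemma past_measurable b : past b `<=` measurable.
Proof. exact: gens_measurable. Qed.

Lemma fut_measurable b : fut b `<=` measurable.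
Proof. exact: gens_measurable. Qed.

Lemma pastI b : setI_closed (past b).
Proof.
move=> A B pA pB.
exact: (@measurableI _ (g_sigma_algebraType (gens _ input_events (past_idx b)))).
Qed.

Lemma past_le (a b : {ffun 'I_L -> nat}) :
  [forall l, (a l <= b l)%N] -> past a `<=` past b.
Proof.
move=> /forallP ab; apply: sub_smallest2r => // A [i ai Ai]; exists i => //.
case: i ai {Ai} => [[l|[l n]]|[l n]]//= [m [ma nm]]; exists m; split=> //;
  exact: leq_trans (ab l).
Qed.

Lemma past_fut_indep b A B : past b A -> fut b B -> (P (A `&` B) = P A * P B)%E.
Proof.
apply: (mutual_indep_sigma P _ _ _ input_measurable input_eventsT input_eventsI _ _ _ _ input_indep).
- by case=> [[l|[l n]]|[l n]]//= [m [_ ->]].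
- by case=> [[l|[l n]]|[l n]]//= [m [_ ->]].
- apply/seteqP; split=> // -[[l|[l n]]|[l n]] [] //= [m [mb nm]] [m' [mb' nm']].
    move: nm'; rewrite nm => -[mm]; by move: mb'; rewrite -mm leqNgt mb.
  move: nm'; rewrite nm => /oppr_inj -[mm]; by move: mb'; rewrite -mm leqNgt mb.
Qed.

Lemma gens_measurable_fun (S : set (idx L)) i (Y : Omega -> R) : S i ->
  (forall B, measurable B -> input_events i (Y @^-1` B)) ->
  measurable_fun setT (Y : g_sigma_algebraType (gens _ input_events S) -> R).
Proof.
move=> Si Yi _ B mB; rewrite setTI; apply: sub_sigma_algebra; exists i => //.
exact: Yi.
Qed.

Lemma gap_events l n (B : set R) : measurable B ->
  input_events (inl (inr (l, Negz n))) (back_gap T l n @^-1` B).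
Proof. by move=> mB; exists B => //; rewrite back_gapE. Qed.

Lemma service_events l n (B : set R) : measurable B ->
  input_events (inr (l, - n%:Z)) (back_service V l n @^-1` B).
Proof. by move=> mB; exists B. Qed.

Section past_future.
Variable b : {ffun 'I_L -> nat}.
Let Past := g_sigma_algebraType (gens _ input_events (past_idx b)).
Let Fut := g_sigma_algebraType (gens _ input_events (fut_idx b)).

Lemma past_gap l n : (n < b l)%N -> measurable_fun setT (back_gap T l n : Past -> R).
Proof.
move=> nb; apply: (gens_measurable_fun _ (inl (inr (l, Negz n)))); first by exists n.
exact: gap_events.
Qed.

Lemma past_service l n : (n < b l)%N -> measurable_fun setT (back_service V l n : Past -> R).
Proof.
move=> nb; apply: (gens_measurable_fun _ (inr (l, - n%:Z))); first by exists n.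
exact: service_events.
Qed.

Lemma fut_gap l n : (b l <= n)%N -> measurable_fun setT (back_gap T l n : Fut -> R).
Proof.
move=> nb; apply: (gens_measurable_fun _ (inl (inr (l, Negz n)))); first by exists n.
exact: gap_events.
Qed.

Lemma fut_service l n : (b l <= n)%N -> measurable_fun setT (back_service V l n : Fut -> R).
Proof.
move=> nb; apply: (gens_measurable_fun _ (inr (l, - n%:Z))); first by exists n.
exact: service_events.
Qed.

Lemma past_age l n : (n <= b l)%N -> measurable_fun setT (back_age T l n : Past -> R).
Proof.
elim: n => [_|n IH nb].
  apply: (gens_measurable_fun _ (inl (inl l))) => // B mB.
  exists (B `*` setT); first exact: measurableX.
  by apply/seteqP; split=> w /=; rewrite /back_age oppr0//; case.
rewrite (_ : back_age T l n.+1 = (fun w => back_age T l n w + back_gap T l n w)); last first.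
  by apply/funext => w; rewrite back_ageS.
by apply: measurable_funD; [exact: (IH (ltnW nb))|exact: past_gap].
Qed.

End past_future.

Definition passage (y : R) (b : {ffun 'I_L -> nat}) : set Omega :=
  [set w | forall l, first_passage (back_age T l ^~ w) y (b l)].

Lemma past_passage y b : past b (passage y b).
Proof.
apply: (@measurable_forall _ (g_sigma_algebraType (gens _ input_events (past_idx b)))) => l.
apply: measurableI; first by apply: measurable_set_le => //; exact: past_age.
apply: measurable_forall => m; apply: measurable_imply => mb.
by apply: measurable_set_lt => //; apply: past_age; exact: ltnW.
Qed.

Lemma passage_inj y a b w : passage y a w -> passage y b w -> a = b.
Proof.
move=> ya yb; apply/ffunP => l.
have [a1 a2] := ya l; have [b1 b2] := yb l.
apply/eqP; rewrite eqn_leq; apply/andP; split; rewrite leqNgt; apply/negP.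
  by move=> /a2; rewrite ltNge b1.
by move=> /b2; rewrite ltNge a1.
Qed.

Variables (c z : 'I_L -> R) (M : 'I_L -> nat) (n0 : nat) (r : R).

(** [A] is either the truncation below the next passage or [xpredT]; [m] runs over the shifts at
    which [window_load] may start counting. *)
Definition window_bad (A : 'I_L -> pred nat) (a : {ffun 'I_L -> nat}) : set Omega :=
  [set w | exists l, exists m, (m <= M l)%N /\
    overload (pos_part (back_gap T l)) (back_service V l) (A l) (c l) n0 (M l) r (z l)
      (a l + m) w].

Lemma past_window_bad a b : past b (window_bad (fun l i => i < b l)%N a).
Proof.
apply: (@measurable_exists _ (g_sigma_algebraType (gens _ input_events (past_idx b)))) => l.
apply: measurable_exists => m; apply: measurable_and_const => _.
apply: overload_measurable => [i j jb ij|i _ ib|i _ ib]; first exact: ltn_trans ij jb.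
  by apply: measurable_maxr => //; exact: past_gap.
exact: past_service.
Qed.

Lemma fut_window_bad a : fut a (window_bad (fun=> xpredT) a).
Proof.
apply: (@measurable_exists _ (g_sigma_algebraType (gens _ input_events (fut_idx a)))) => l.
apply: measurable_exists => m; apply: measurable_and_const => _.
apply: overload_measurable => // i mi _.
  by apply: measurable_maxr => //; apply: fut_gap; apply: leq_trans mi; exact: leq_addr.
by apply: fut_service; apply: leq_trans mi; exact: leq_addr.
Qed.

Lemma window_bad_sub a b :
  window_bad (fun l i => i < b l)%N a `<=` window_bad (fun=> xpredT) a.
Proof.
move=> w [l [m [mM []]]]; last first.
  move=> h; exists l, m; split=> //; right; apply: lt_le_trans h _.
  by rewrite big_mkcond/=; apply: ler_sum => i _; case: ifP.
move=> [[j [n0j _ h]]|[j [_ h]]]; exists l, m; split=> //; left; [left|right]; by exists j.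
Qed.

Definition far_bad (n1 : 'I_L -> nat) (wd : R) (b : {ffun 'I_L -> nat}) : set Omega :=
  [set w | exists l, slow (pos_part (back_gap T l)) xpredT (c l) (n1 l) (b l) w \/
     long (back_service V l) xpredT (c l) wd (b l) w].

Lemma fut_far_bad n1 wd b : fut b (far_bad n1 wd b).
Proof.
apply: (@measurable_exists _ (g_sigma_algebraType (gens _ input_events (fut_idx b)))) => l.
apply: measurableU.
  apply: slow_measurable => // i bi _.
  by apply: measurable_maxr => //; exact: fut_gap.
apply: long_measurable => i bi _; exact: fut_service.
Qed.

(** Only gaps older than job 0 occur here; the length-biased gap straddling time 0 is not among
    them, so all have the law of [X0 / s]. *)
Lemma gap_stream l :
  iid_stream P _ input_dom input_events (fun n => inl (inr (l, Negz n)))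
    (back_gap T l) (fun w => X0 l w / s%:R).
Proof.
case: inp => _ _ [lawX _] _ _; split=> //.
- by move=> m n [].
- by move=> n B; exact: gap_events.
- by move=> n; rewrite back_gapE; exact: lawX.
Qed.

Lemma service_stream l :
  iid_stream P _ input_dom input_events (fun n => inr (l, - n%:Z))
    (back_service V l) (V0 l).
Proof.
case: inp => _ _ [_ lawV] _ _; split=> //.
- by move=> m n [] /oppr_inj [].
- by move=> n B; exact: service_events.
- by move=> n; exact: lawV.
Qed.

End stationary.

(** * Expectation from layered tail bounds *)

Section layer_cake.
Context {d : measure_display} {Omega : measurableType d} {R : realType}.
Variable P : probability Omega R.

Lemma probabilityU_le (A B : set Omega) (a b : \bar R) : measurable A -> measurable B ->
  (P A <= a -> P B <= b -> P (A `|` B) <= a + b)%E.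
Proof. by move=> mA mB Aa Bb; apply: (le_trans (measureU2 _ mA mB)); exact: leeD. Qed.

Lemma null_exists (B : countType) (Q : B -> set Omega) :
  (forall b, measurable (Q b)) -> (forall b, P (Q b) = 0%E) ->
  P [set w | exists b, Q b w] = 0%E.
Proof.
move=> mQ PQ; apply/eqP; rewrite -measure_le0.
pose E n := if pickle_inv n is Some b then Q b else set0.
rewrite (_ : [set w | _] = \bigcup_n E n); last first.
  apply/seteqP; split=> w.
    by move=> [b Qb]; exists (pickle b); rewrite /E ?pickleK_inv.
  by move=> [n _]; rewrite /E; case: pickle_inv => // b Qb; exists b.
apply: (bigcup_le P E (fun=> 0)) => [n|n|n]; last by rewrite sumr_const mul0rn.
- by rewrite /E; case: pickle_inv.
- by rewrite /E; case: pickle_inv => [b|]; rewrite ?PQ ?measure0.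
Qed.

(* No measurability of [f]: the integral of a nonnegative function is a supremum
   over simple functions. *)
Lemma ge0_le_integral_any (f g : Omega -> \bar R) : (forall w, 0 <= f w)%E ->
  (forall w, f w <= g w)%E -> (\int[P]_w f w <= \int[P]_w g w)%E.
Proof.
move=> f0 fg; rewrite !ge0_integralTE//; last by move=> w; exact: le_trans (fg w).
apply: ereal_sup_le => _ [h hf <-]; exists h => // w.
exact: le_trans (hf w) (fg w).
Qed.

(** Pointwise, [f] is at most [x 0] plus the sum of [x k.+1] over the [k] with [B k]: if [k.+1] is
    the first index outside, the term of [k] alone suffices. If there is none, the series diverges
    because [x >= 1]. *)
Lemma layered_expectation (f : Omega -> \bar R) (B : nat -> set Omega) (x b : nat -> R) (S : R) :
  (forall w, 0 <= f w)%E -> (forall k, measurable (B k)) -> (forall k, 1 <= x k) ->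
  (forall k w, ~ B k w -> f w <= (x k)%:E)%E -> (forall k, P (B k) <= (b k)%:E)%E ->
  (forall n, \sum_(k < n) x k.+1 * b k <= S) ->
  (\int[P]_w f w <= (x 0%N + S)%:E)%E.
Proof.
move=> f0 mB x1 fB PB xbS.
have x0 k : 0 <= x k by apply: le_trans (x1 k).
pose h k w : \bar R := (x k.+1 * \1_(B k) w)%:E.
have h0 k w : (0 <= h k w)%E by rewrite lee_fin mulr_ge0.
have mh k : measurable_fun setT (h k).
  by apply/measurable_EFinP; apply: measurable_funM => //; exact: measurable_indic.
have fle w : (f w <= (x 0%N)%:E + \sum_(0 <= k <oo) h k w)%E.
  have [allB|] := pselect (forall k, B k w).
    apply: (@le_trans _ _ +oo%E); first exact: leey.
    suff -> : (\sum_(0 <= k <oo) h k w = +oo)%E by [].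
    apply: eq_infty => t.
    apply: le_trans (nneseries_lim_ge (Num.trunc `|t|).+1 (fun k _ _ => h0 k w)).
    apply: (@le_trans _ _ (\sum_(0 <= k < (Num.trunc `|t|).+1) 1)%E).
      rewrite big_mkord sumEFin lee_fin sumr_const card_ord.
      by apply: (le_trans (ler_norm t)); apply/ltW; exact: truncnS_gt.
    by apply: lee_sum => k _; rewrite /h indicE mem_set// mulr1 lee_fin.
  move=> /existsNP nB.
  have exn : exists k, `[< ~ B k w >] by case: nB => k nBk; exists k; apply/asboolP.
  case: (ex_minnP exn) => -[|k] /asboolP nBk kmin.
    by apply: le_trans (fB _ _ nBk) _; rewrite leeDl// nneseries_ge0.
  have Bk : B k w.
    by apply: contrapT => h1; have := kmin k; rewrite ltnn => /(_ (introT (asboolP _) h1)).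
  apply: le_trans (fB _ _ nBk) _; apply: (@le_trans _ _ (h k w)).
    by rewrite /h indicE mem_set// mulr1.
  rewrite -[leLHS]add0e leeD ?lee_fin//.
  apply: le_trans (nneseries_lim_ge k.+1 (fun k _ _ => h0 k w)).
  by rewrite big_nat_recr//= leeDr// sume_ge0.
apply: (le_trans (ge0_le_integral_any _ _ f0 fle)).
rewrite ge0_integralD//; first last.
- exact: ge0_emeasurable_sum.
- by move=> w _; exact: nneseries_ge0.
- by move=> w _; rewrite lee_fin.
rewrite integral_cst// [X in (_ * X + _)%E](_ : _ = 1%E); last exact: probability_setT.
rewrite mule1 EFinD leeD2l//.
rewrite integral_nneseries//.
apply: lime_le; first by apply: is_cvg_nneseries => n _ _; exact: integral_ge0.
apply: nearW => n; rewrite big_mkord.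
apply: (@le_trans _ _ (\sum_(k < n) (x k.+1 * b k)%:E)%E); last by rewrite sumEFin lee_fin.
apply: lee_sum => k _; rewrite /h.
under eq_integral do rewrite EFinM.
rewrite ge0_integralZl//; last by rewrite lee_fin.
  rewrite integral_indic// setIT EFinM; apply: lee_wpmul2l; first by rewrite lee_fin.
  exact: PB.
by apply/measurable_EFinP; exact: measurable_indic.
Qed.
End layer_cake.

(** * The bound for one fixed [s] *)

Section scale.
Context {d : measure_display} {Omega : measurableType d} {R : realType} {J L : nat}.
Variables (P : probability Omega R) (X0 V0 : 'I_L -> Omega -> R) (s : nat)
  (T V : 'I_L -> int -> Omega -> R).
Hypothesis inp : stationary_input P X0 V0 s T V.
Hypotheses (mX0 : forall l, measurable_fun setT (X0 l))
  (s0 : (0 < s)%N) (X0pos : forall l, P [set w | 0 < X0 l w] = 1%E)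
  (null : forall l (m : nat),
    P [set w | forall n, \sum_(i < n) pos_part (back_gap T l) i w < m%:R] = 0%E).

Definition irregular : set Omega :=
  [set w | exists x : 'I_L * int, x.2 != 0 /\ gap T x.1 x.2 w <= 0] `|`
  [set w | exists x : 'I_L * nat,
     forall n, \sum_(i < n) pos_part (back_gap T x.1) i w < x.2%:R].

Let mgap l n : measurable_fun setT (gap T l n).
Proof. by case: inp => -[mT _] _ _ _ _; exact: measurable_funB. Qed.

Let mpos l n : measurable_fun setT (pos_part (back_gap T l) n).
Proof. by apply: measurable_maxr => //; rewrite back_gapE. Qed.

Let measurable_gap_le0 (x : 'I_L * int) :
  measurable [set w | x.2 != 0 /\ gap T x.1 x.2 w <= 0].
Proof. by apply: measurable_and_const => _; exact: measurable_set_le. Qed.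

Let measurable_bounded_sum (x : 'I_L * nat) :
  measurable [set w | forall n, \sum_(i < n) pos_part (back_gap T x.1) i w < x.2%:R].
Proof.
by apply: measurable_forall => n; apply: measurable_set_lt => //; exact: measurable_sum.
Qed.

Lemma irregular_measurable : measurable irregular.
Proof. by apply: measurableU; exact: measurable_exists. Qed.

Lemma irregular_null : P irregular = 0%E.
Proof.
have h2 : P [set w | exists x : 'I_L * nat,
     forall n, \sum_(i < n) pos_part (back_gap T x.1) i w < x.2%:R] = 0%E.
  by apply: (null_exists P _ (fun x => [set w | forall n,
    \sum_(i < n) pos_part (back_gap T x.1) i w < x.2%:R])) => // -[l m]; exact: null.
suff h1 : P [set w | exists x : 'I_L * int, x.2 != 0 /\ gap T x.1 x.2 w <= 0] = 0%E.
  apply/eqP; rewrite -measure_le0 -[leRHS]adde0; apply: probabilityU_le.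
  - exact: (measurable_exists _ _ measurable_gap_le0).
  - exact: (measurable_exists _ _ measurable_bounded_sum).
  - by rewrite h1.
  - by rewrite h2.
apply: (null_exists P _ (fun x => [set w | x.2 != 0 /\ gap T x.1 x.2 w <= 0])) => // -[l n] /=.
have [->|n0] := eqVneq n 0.
  by rewrite (_ : [set w | _] = set0) ?measure0//; apply/seteqP; split=> w //= -[].
have mB : measurable (`]-oo, 0] : set R)%classic by [].
have EE (f : Omega -> R) : f @^-1` `]-oo, 0] = [set w | f w <= 0].
  by apply/seteqP; split=> w; rewrite /= in_itv.
rewrite (_ : [set w | _] = [set w | gap T l n w <= 0]); last first.
  by apply/seteqP; split=> w //= -[].
case: inp => _ _ [lawX _] _ _; have := lawX l n n0 _ mB; rewrite !EE => ->.
have mXp : measurable [set w | 0 < X0 l w] by exact: measurable_set_lt.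
rewrite (_ : [set w | _] = ~` [set w | 0 < X0 l w]).
  by rewrite probability_setC// X0pos subee.
apply/seteqP; split=> w /=.
  by move=> h h'; move: h; rewrite leNgt divr_gt0// ltr0n.
by move=> /negP; rewrite -leNgt => h; rewrite pmulr_lle0// invr_gt0 ltr0n.
Qed.

Lemma regular_compl w : ~ irregular w -> regular T w.
Proof.
move=> nI; have gpos l n : n != 0 -> 0 < gap T l n w.
  move=> n0; rewrite ltNge; apply/negP => h; apply: nI; left; by exists (l, n).
have gb l n : 0 <= back_gap T l n w by rewrite back_gapE ltW// gpos.
case: (inp) => _ T01 _ _ _; split=> //.
- move=> l; elim=> [|n IH]; first by have [] := T01 l w.
  have := gpos l n.+1%:Z isT; rewrite /gap -PoszD addn1; lra.
- move=> l y; apply: contrapT => nex; apply: nI; right.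
  exists (l, (Num.trunc `|y|).+1) => n /=; apply: contrapT => /negP; rewrite -leNgt => h.
  apply: nex; exists n; apply: (le_trans (ler_norm y)); apply/ltW.
  apply: (lt_le_trans (truncnS_gt _)); apply: (le_trans h).
  have stepE k : back_age T l k.+1 w = back_age T l k w + pos_part (back_gap T l) k w.
    by rewrite back_ageS /pos_part max_l.
  have := tau_psum (back_age T l ^~ w) _ stepE 0 n; rewrite add0n => ->.
  by rewrite lerDr /back_age oppr0 oppr_ge0; have [] := T01 l w.
Qed.

Variables (Pm : 'I_L -> 'I_J -> bool) (C : 'I_J -> nat) (c z : 'I_L -> R)
  (M : 'I_L -> nat) (n1 : nat -> 'I_L -> nat) (n0 : nat) (r : R).
Hypotheses (r1 : 1 <= r) (c0 : forall l, 0 < c l) (z0 : forall l, 0 <= z l)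
  (Mr : forall l, r <= (M l)%:R * c l) (n0r : forall l, n0%:R * c l <= r)
  (n1w : forall i l, (n1 i l)%:R * c l <= 2 ^+ i * r)
  (capacity : forall j, \sum_(l < L | Pm l j) (n0%:R + z l) <= (s * C j)%:R)
  (Pwindow : forall a, (P (window_bad T V c z M n0 r (fun=> xpredT) a) <= (8^-1)%:E)%E)
  (Pfar : forall i b, (P (far_bad T V c (n1 i) (2 ^+ i * r) b) <= (16^-1 ^+ i)%:E)%E).

(** Doubling leaves [y i.+1 - y i - r >= 2^i r], the room given to the far jobs of window [i]. *)
Let y i : R := 2 ^+ i.+1 * r.

Let y0 i : 0 < y i.
Proof. by rewrite mulr_gt0 ?exprn_gt0//; have := r1; lra. Qed.

Let leB (a b : {ffun 'I_L -> nat}) := [forall l, (a l <= b l)%N].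

Let run := @bad_run _ Omega {ffun 'I_L -> nat} leB (fun i => passage T (y i))
  (fun a b => window_bad T V c z M n0 r (fun l i => i < b l)%N a).

(* The windows [k <= i < 2 k] all fail, up to far jobs and a null set. *)
Let failure k : set Omega := irregular `|`
  \bigcup_a (passage T (y k) a `&` run k k a) `|`
  \big[setU/set0]_(k <= i < 2 * k)
    (\bigcup_b (passage T (y i.+1) b `&` far_bad T V c (n1 i) (2 ^+ i * r) b)).

Let mpassage i b : measurable (passage T (y i) b).
Proof. exact: (past_measurable _ _ _ _ _ _ inp b _ (past_passage T V (y i) b)). Qed.

Let mrun i m a : measurable (run i m a).
Proof.
apply: (bad_run_measurable _ leB (past T V)) => //.
- exact: (past_measurable _ _ _ _ _ _ inp).
- by move=> *; exact: past_passage.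
- by move=> *; exact: past_window_bad.
Qed.

Let mfar i : measurable
  (\bigcup_b (passage T (y i.+1) b `&` far_bad T V c (n1 i) (2 ^+ i * r) b)).
Proof.
apply: bigcup_countType_measurable => b; apply: measurableI => //.
by apply: (fut_measurable _ _ _ _ _ _ inp b); exact: fut_far_bad.
Qed.

Let mfailure k : measurable (failure k).
Proof.
apply: measurableU; first apply: measurableU; first exact: irregular_measurable.
  by apply: bigcup_countType_measurable => a; exact: measurableI.
by apply: big_ind => // A B; exact: measurableU.
Qed.

Let Prun k : (P (\bigcup_a (passage T (y k) a `&` run k k a)) <= ((8^-1 : R) ^+ k)%:E)%E.
Proof.
apply: (bad_runs_le P _ leB (past T V) (fut T V)) => //.
- exact: (past_measurable _ _ _ _ _ _ inp).
- exact: (fut_measurable _ _ _ _ _ _ inp).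
- exact: pastI.
- exact: past_le.
- exact: (past_fut_indep _ _ _ _ _ _ inp).
- by move=> *; exact: past_passage.
- by move=> i a b w; exact: passage_inj.
- by move=> *; exact: past_window_bad.
- by move=> *; exact: window_bad_sub.
- by move=> *; exact: fut_window_bad.
Qed.

Let Pfar_stopped i : (P (\bigcup_b (passage T (y i.+1) b `&`
   far_bad T V c (n1 i) (2 ^+ i * r) b)) <= ((16^-1 : R) ^+ i)%:E)%E.
Proof.
apply: (stopped_le P _ (past T V) (fut T V) (fun i => passage T (y i))) => //.
- exact: (past_measurable _ _ _ _ _ _ inp).
- exact: (fut_measurable _ _ _ _ _ _ inp).
- exact: (past_fut_indep _ _ _ _ _ _ inp).
- by move=> *; exact: past_passage.
- by move=> j a b w; exact: passage_inj.
- by move=> *; exact: fut_far_bad.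
Qed.

Let Pfailure k : (P (failure k) <= (2 * 8^-1 ^+ k)%:E)%E.
Proof.
have h1 := irregular_null; have h2 := Prun k.
have mr : measurable (\bigcup_a (passage T (y k) a `&` run k k a)).
  by apply: bigcup_countType_measurable => a; exact: measurableI.
have h3 : (P (\big[setU/set0]_(k <= i < 2 * k) (\bigcup_b (passage T (y i.+1) b `&`
   far_bad T V c (n1 i) (2 ^+ i * r) b))) <= ((8^-1 : R) ^+ k)%:E)%E.
  apply: (le_trans (measure_bigsetU_le P _ _ _ _)) => //.
  apply: (@le_trans _ _ (\sum_(k <= i < 2 * k) ((16^-1 : R) ^+ k)%:E)%E).
    rewrite [leLHS]big_nat_cond [leRHS]big_nat_cond; apply: lee_sum => i /andP[/andP[ki _] _].
    apply: (le_trans (Pfar_stopped i)); rewrite lee_fin.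
    by apply: ler_wiXn2l => //; lra.
  rewrite sumEFin lee_fin sumr_const_nat.
  have -> : (2 * k - k = k)%N by lia.
  (* There are [k] far terms, and [k 16^-k <= 8^-k] because [k <= 2^k]. *)
  have -> : (16^-1 : R) = 8^-1 * 2^-1 by lra.
  rewrite exprMn -mulrnAr ler_piMr ?exprn_ge0 ?invr_ge0//.
  rewrite -mulr_natr exprVn mulrC ler_pdivrMr ?exprn_gt0// mul1r -natrX ler_nat.
  by rewrite ltnW// ltn_expl.
rewrite mulr2n mulrDl mul1r EFinD; apply: probabilityU_le => //.
- by apply: measurableU => //; exact: irregular_measurable.
- by apply: big_ind => // A B; exact: measurableU.
- rewrite -[leRHS]add0e; apply: probabilityU_le => //; first exact: irregular_measurable.
  by rewrite h1.
Qed.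

Let passage_exists w i : regular T w -> exists a, passage T (y i) a w.
Proof.
case=> _ _ ex.
have /choice[a aP] : forall l, exists a, first_passage (back_age T l ^~ w) (y i) a.
  move=> l; case: (ex_minnP (ex l (y i))) => a ya amin; exists a; split=> // m ma.
  by rewrite ltNge; apply/negP => /amin; rewrite leqNgt ma.
by exists [ffun l => a l] => l; rewrite ffunE.
Qed.

(** Either some window [k <= i < 2k] passes the truncated test, and the exclusion of its far event
    makes it a good window, or all of them fail and the path belongs to the run. *)
Let tau'_le k w : ~ failure k w -> (`| tau' Pm C s T V w | <= (y (2 * k) + r)%:E)%E.
Proof.
move=> nf; have r1' := r1; have reg : regular T w.
  by apply: regular_compl => h; apply: nf; left; left.
have /choice[a aP] : forall i, exists a, passage T (y i) a w.
  by move=> i; exact: passage_exists.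
have [[i /andP[ki i2k] nb]|] := pselect (exists2 i, (k <= i < 2 * k)%N &
    ~ window_bad T V c z M n0 r (fun l j => j < a i.+1 l)%N (a i) w).
  have nfar : ~ far_bad T V c (n1 i) (2 ^+ i * r) (a i.+1) w.
    move=> h; apply: nf; right; rewrite -bigcup_seq; exists i.
      by rewrite /= mem_index_iota ki.
    by exists (a i.+1).
  apply: (@le_trans _ _ (y i + r)%:E); last first.
    rewrite lee_fin lerD2r ler_pM2r; last lra.
    by apply: ler_weXn2l; [lra|lia].
  apply: (window_tau' Pm C s T V c z M (n1 i) n0 (y i) r (2 ^+ i * r) (y i.+1) (a i) (a i.+1) w) => //.
  - lra.
  - by rewrite mulr_ge0 ?exprn_ge0//; lra.
  - rewrite /y !exprS; have : 1 <= (2 : R) ^+ i by apply: exprn_ege1; lra.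
    have := r1; nra.
  - by move=> l; exact: aP.
  - by move=> l; exact: aP.
  - by move=> l m mM h; apply: nb; exists l, m.
  - by move=> l h; apply: nfar; exists l; left.
  - by move=> l h; apply: nfar; exists l; right.
move=> nex; exfalso; apply: nf; left; right; exists (a k) => //; split; first exact: aP.
suff h : forall m i, (k <= i)%N -> (i + m)%N = (2 * k)%N -> run i m (a i) w.
  by apply: h => //; lia.
elim=> [//|m IH] i ki im; rewrite /run -/run /=.
exists (a i.+1) => //; split; first exact: aP.
(* The guard of [bad_run] holds on actual paths: passage indices grow with the level. *)
rewrite ifT; last first.
  apply/forallP => l; have [yi _] := aP i.+1 l.
  apply: (first_passage_le (back_age T l ^~ w) (y i)); first exact: aP.
  apply: le_trans yi; rewrite ler_pM2r; last by have := r1; lra.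
  by apply: ler_weXn2l; [lra|lia].
split; last by apply: IH; lia.
by apply: contrapT => nb; apply: nex; exists i => //; apply/andP; split; lia.
Qed.

Lemma expected_tau'_le : (\int[P]_w `| tau' Pm C s T V w | <= (51 * r)%:E)%E.
Proof.
have r1' := r1.
(* Layer 0 costs [y 0 + r = 3 r]. The term of [k] is [16 r 2^-k + 2 r 8^-k <= 24 r 2^-k], in total
   at most [48 r]. *)
apply: (le_trans (layered_expectation P _ failure (fun k => y (2 * k) + r)
  (fun k => 2 * 8^-1 ^+ k) (48 * r) _ mfailure _ tau'_le Pfailure _)).
- by move=> w; exact: abse_ge0.
- move=> k; have := y0 (2 * k); lra.
- move=> n; apply: (@le_trans _ _ (\sum_(k < n) 24 * r * (2^-1 ^+ (0 + k)))).
    apply: ler_sum => k _; rewrite add0n /y.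
    have -> : (2 * k.+1).+1 = (k + k + 3)%N by lia.
    rewrite !exprD -mulrA.
    have -> : (8^-1 : R) = 2^-1 * 2^-1 * 2^-1 by lra.
    rewrite !exprMn.
    have k2 : (2 : R) ^+ k * 2^-1 ^+ k = 1 by rewrite -exprMn divff ?expr1n.
    have k0 : 1 <= (2 : R) ^+ k by apply: exprn_ege1; lra.
    have h0 : 0 < (2^-1 : R) ^+ k by apply: exprn_gt0; lra.
    have -> : (2 : R) ^+ 3 = 8 by ring.
    move: k2 k0 h0; set A := 2 ^+ k; set B := 2^-1 ^+ k => k2 k0 h0.
    rewrite (_ : _ * _ = 16 * r * (A * B) * (A * B) * B + 2 * r * (B * B) * B); last by ring.
    rewrite k2 !mulr1.
    have B1 : B <= 1 by nra.
    have : B * B <= 1 by nra.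
    have : 0 < r * B by nra.
    nra.
  rewrite -mulr_sumr.
  have half : 0 <= (2^-1 : R) < 1 by apply/andP; split; lra.
  have := geometric_tail (2^-1 : R) 0 n half; rewrite expr0.
  have -> : 1 / (1 - 2^-1) = 2 :> R by field.
  set S := \sum_(_ < _) _ => S2.
  rewrite (_ : 48 * r = 24 * r * 2); last by ring.
  by rewrite ler_pM2l//; lra.
rewrite lee_fin /y muln0; lra.
Qed.

End scale.

Lemma expectation_gt0 {d : measure_display} {Omega : measurableType d} {R : realType}
  (P : probability Omega R) (X : Omega -> R) : measurable_fun setT X ->
  P.-integrable setT (EFin \o X) -> P [set w | 0 < X w] = 1%E -> 0 < fine 'E_P[X]%E.
Proof.
move=> mX iX X1.
have mp : measurable [set w | 0 < X w] by exact: measurable_set_lt.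
have mn : measurable [set w | 0 <= X w] by exact: measurable_set_le.
have X0 : P [set w | 0 <= X w] = 1%E.
  apply/eqP; rewrite eq_le probability_le1//= -X1; apply: le_measure; rewrite ?inE//.
  by move=> w /ltW.
rewrite lt_neqAle (fine_expectation_ge0 P X mX X0) andbT eq_sym.
apply/eqP => E0.
have fE : 'E_P[X]%E \is a fin_num by rewrite unlock; exact: integrable_fin_num.
have : (\int[P]_w `|(Num.max (X w) 0)%:E| = 0)%E.
  rewrite -[RHS](_ : 'E_P[X]%E = 0%E); last by rewrite -(fineK fE) E0.
  rewrite -(expectation_pos P X mX X0); apply: eq_integral => w _.
  by rewrite gee0_abs// lee_fin le_max lexx orbT.
have mm : measurable_fun setT (fun w => (Num.max (X w) 0)%:E).
  by apply/measurable_EFinP; exact: measurable_maxr.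
move=> /(ae_eq_integral_abs P measurableT mm)[N [mN N0 sN]].
have : (P [set w | (0 < X w)%R] <= P N)%E.
  apply: le_measure; rewrite ?inE// => w Xw; apply: sN => /= /(_ I) [].
  by rewrite max_l ?ltW// => h; move: Xw; rewrite /= h ltxx.
by rewrite X1 (_ : P N = 0%E)// leNgt lte01.
Qed.

(** * Union bounds over routes and starting indices *)

Section finite_unions.
Context {d : measure_display} {Omega : measurableType d} {R : realType}.
Variable P : probability Omega R.

Lemma probability_exists_le (I : finType) (Q : I -> set Omega) (q : I -> R) :
  (forall i, measurable (Q i)) -> (forall i, P (Q i) <= (q i)%:E)%E ->
  (P [set w | exists i, Q i w] <= (\sum_i q i)%:E)%E.
Proof.
move=> mQ PQ; rewrite (_ : [set w | _] = \big[setU/set0]_(i <- index_enum I) Q i).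
  apply: (le_trans (measure_bigsetU_le P _ _ _ mQ)); rewrite -sumEFin.
  by apply: lee_sum => i _; exact: PQ.
rewrite -bigcup_seq; apply/seteqP; split=> w [i].
  by move=> Qi; exists i; rewrite //= mem_index_enum.
by move=> _ Qi; exists i.
Qed.

Lemma pos_lower_bound (I : finType) (f : I -> R) : (forall i, 0 < f i) ->
  exists2 e : R, 0 < e & forall i, e <= f i.
Proof.
move=> f0; exists (\big[Num.min/1]_i f i); last first.
  by move=> i; exact: bigmin_le_cond.
by apply: (big_ind (fun x => 0 < x)) => // x y x0 y0; rewrite lt_min x0.
Qed.

Variables (L : nat) (T V : 'I_L -> int -> Omega -> R) (c z : 'I_L -> R)
  (M : 'I_L -> nat) (n0 : nat) (r : R).
Hypotheses (mT : forall l n, measurable_fun setT (T l n))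
  (mV : forall l n, measurable_fun setT (V l n)).

Let mpos l n : measurable_fun setT (pos_part (back_gap T l) n).
Proof. by apply: measurable_maxr => //; apply: measurable_funB. Qed.

Lemma window_bad_le (q1 q2 q3 : 'I_L -> R) a :
  (forall l k, P (slow (pos_part (back_gap T l)) xpredT (c l) n0 k) <= (q1 l)%:E)%E ->
  (forall l k, P (long (back_service V l) xpredT (c l) r k) <= (q2 l)%:E)%E ->
  (forall l k, P (crowd (back_service V l) xpredT (c l) (M l) (z l) k) <= (q3 l)%:E)%E ->
  (P (window_bad T V c z M n0 r (fun=> xpredT) a) <=
   (\sum_l (M l).+1%:R * (q1 l + q2 l + q3 l))%:E)%E.
Proof.
move=> P1 P2 P3.
pose O l m := overload (pos_part (back_gap T l)) (back_service V l) xpredT (c l) n0 (M l) r (z l)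
   (a l + m)%N.
have mO l m : measurable (O l m) by apply: overload_measurable => // *; exact: mV.
have -> : window_bad T V c z M n0 r (fun=> xpredT) a =
    [set w | exists l, [set w | exists m : 'I_(M l).+1, O l m w] w].
  apply/seteqP; split=> w [l].
    by move=> [m [mM Om]]; exists l, (Ordinal (mM : (m < (M l).+1)%N)).
  by move=> [m Om]; exists l, m; split=> //; rewrite -ltnS.
apply: probability_exists_le => l; first exact: measurable_exists.
rewrite [X in X%:E](_ : _ = \sum_(m < (M l).+1) (q1 l + q2 l + q3 l)); last first.
  by rewrite sumr_const card_ord mulr_natl.
apply: probability_exists_le => m //; rewrite !EFinD.
apply: probabilityU_le => //.
- apply: measurableU; [exact: slow_measurable|].
  by apply: long_measurable => *; exact: mV.
- by apply: crowd_measurable => *; exact: mV.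
apply: probabilityU_le => //; first exact: slow_measurable.
by apply: long_measurable => *; exact: mV.
Qed.

Lemma far_bad_le (n1 : 'I_L -> nat) (wd : R) (q1 q2 : 'I_L -> R) b :
  (forall l k, P (slow (pos_part (back_gap T l)) xpredT (c l) (n1 l) k) <= (q1 l)%:E)%E ->
  (forall l k, P (long (back_service V l) xpredT (c l) wd k) <= (q2 l)%:E)%E ->
  (P (far_bad T V c n1 wd b) <= (\sum_l (q1 l + q2 l))%:E)%E.
Proof.
move=> P1 P2.
have ms l : measurable (slow (pos_part (back_gap T l)) xpredT (c l) (n1 l) (b l)).
  exact: slow_measurable.
have ml l : measurable (long (back_service V l) xpredT (c l) wd (b l)).
  by apply: long_measurable => *; exact: mV.
apply: (probability_exists_le _ (fun l => slow _ _ _ _ _ `|` long _ _ _ _ _)) => l.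
  exact: measurableU.
by rewrite EFinD; apply: probabilityU_le.
Qed.

(** If all partial sums stay below [m], the path is in [slow] for every [n >= m / c l], and these
    probabilities tend to 0. *)
Lemma bounded_sum_null (l : 'I_L) (K : R) (m : nat) : 0 < c l ->
  (forall n, P (slow (pos_part (back_gap T l)) xpredT (c l) n 0) <= (K / n.+1%:R ^+ 4)%:E)%E ->
  P [set w | forall n, \sum_(i < n) pos_part (back_gap T l) i w < m%:R] = 0%E.
Proof.
move=> c0 PK; set E := [set w | _].
have mE : measurable E.
  by apply: measurable_forall => n; apply: measurable_set_lt => //; exact: measurable_sum.
have EK n : m%:R / c l <= n%:R -> fine (P E) * n%:R <= K.
  move=> mn; have En : (P E <= (K / n.+1%:R ^+ 4)%:E)%E.
    apply: le_trans (PK n); apply: le_measure; rewrite ?inE//.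
      exact: slow_measurable.
    move=> w Ew; exists n; split=> //; under eq_bigr do rewrite add0n.
    by apply: lt_le_trans (Ew n) _; rewrite -ler_pdivrMr.
  have : fine (P E) <= K / n.+1%:R ^+ 4 by rewrite -lee_fin fineK// fin_num_measure.
  rewrite ler_pdivlMr ?exprn_gt0//; apply: le_trans.
  rewrite ler_wpM2l ?fine_ge0// (@le_trans _ _ n.+1%:R) ?ler_nat//.
  by rewrite -[leLHS]expr1 ler_weXn2l// ler1n.
have p0 : 0 <= fine (P E) by rewrite fine_ge0.
suff : fine (P E) = 0 by move=> h; rewrite -(fineK (fin_num_measure P E mE)) h.
apply/eqP; rewrite eq_le p0 andbT leNgt; apply/negP => pE.
pose x := `|m%:R / c l| + `|K / fine (P E)|.
have := EK (Num.trunc x).+1.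
have xn := truncnS_gt x.
have x1 := ler_norm (m%:R / c l); have x2 := ler_norm (K / fine (P E)).
have x3 := normr_ge0 (m%:R / c l); have x4 := normr_ge0 (K / fine (P E)).
move=> /(_ _)H; have := H ltac:(rewrite /x in xn *; lra).
rewrite leNgt => /negP; apply; rewrite mulrC -ltr_pdivrMr//.
rewrite /x in xn; lra.
Qed.

End finite_unions.

Lemma ex2_conj {T : Type} (A B : T -> Prop) :
  (exists2 x, A x & B x) -> exists x, A x /\ B x.
Proof. by case=> x; exists x. Qed.

(** * Choice of rates and constants as [s] grows *)

Section asymptotics.
Context {d : measure_display} {Omega : measurableType d} {R : realType} {J L : nat}.
Variables (P : probability Omega R) (Pm : 'I_L -> 'I_J -> bool) (C : 'I_J -> nat)
  (X0 V0 : 'I_L -> Omega -> R).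
Hypotheses (mX : forall l, measurable_fun setT (X0 l))
  (iX : forall l, P.-integrable setT (fun w => (X0 l w)%:E))
  (Xpos : forall l, P [set w | 0 < X0 l w] = 1%E)
  (mV : forall l, measurable_fun setT (V0 l))
  (Vpos : forall l, P [set w | 0 <= V0 l w] = 1%E)
  (iV : forall l (q : R), 0 < q -> P.-integrable setT (fun w => (V0 l w `^ q)%:E))
  (traffic : forall j : 'I_J,
     \sum_(l < L | Pm l j) fine ('E_P[V0 l]) / fine ('E_P[X0 l]) < (C j)%:R).

Let EX l := fine ('E_P[X0 l]).
Let EV l := fine ('E_P[V0 l]).

Let EX0 l : 0 < EX l.
Proof. exact: (expectation_gt0 P (X0 l) (mX l) (iX l) (Xpos l)). Qed.

Let EV0 l : 0 <= EV l.
Proof. exact: (fine_expectation_ge0 P (V0 l) (mV l) (Vpos l)). Qed.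

Let Xge0 l : P [set w | 0 <= X0 l w] = 1%E.
Proof.
have mp : measurable [set w | 0 < X0 l w] by exact: measurable_set_lt.
have mn : measurable [set w | 0 <= X0 l w] by exact: measurable_set_le.
apply/eqP; rewrite eq_le probability_le1//= -(Xpos l); apply: le_measure; rewrite ?inE//.
by move=> w /ltW.
Qed.

(** The spare capacity is split over the routes, two shares [e] each: one for the [n0] uncontrolled
    jobs, one for the margin in [zeta]. The bound on [e * EX l] serves [n0 * c <= 1 <= r]. *)
Lemma slack_exists : exists2 e : R, 0 < e &
  (forall j, \sum_(l < L | Pm l j) (e + (EV l / EX l + e)) <= (C j)%:R) /\
  (forall l, e * EX l <= 1).
Proof.
pose slack j := (C j)%:R - \sum_(l < L | Pm l j) EV l / EX l.
have [j|e1 e10 e1P] := pos_lower_bound _ (fun j => slack j / (2 * L.+1%:R)).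
  by rewrite divr_gt0 ?mulr_gt0 ?ltr0n// subr_gt0; exact: traffic.
have [l|e2 e20 e2P] := pos_lower_bound _ (fun l => (EX l)^-1); first by rewrite invr_gt0.
exists (Num.min e1 e2); first by rewrite lt_min e10.
set e := Num.min _ _; have e0 : 0 < e by rewrite lt_min e10.
split=> [j|l]; last first.
  rewrite -ler_pdivlMr// div1r; apply: le_trans (e2P l).
  by rewrite ge_min lexx orbT.
have : e <= slack j / (2 * L.+1%:R) by apply: le_trans (e1P j); rewrite ge_min lexx.
rewrite ler_pdivlMr ?mulr_gt0 ?ltr0n// /slack lerBrDl; apply: le_trans.
under eq_bigr do rewrite addrCA.
rewrite big_split/= lerD2l sumr_const -(mulr_natr (e + e)).
rewrite (_ : e * (2 * L.+1%:R) = (e + e) * L.+1%:R); last by ring.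
apply: ler_wpM2l; first by lra.
by rewrite ler_nat; apply: leq_trans (max_card _) _; rewrite card_ord.
Qed.

(** The hypothesis [s^6 <= r^(N+1)] turns the bound [s^2 / r^(N+1)] on long services into [s^-4],
    matching the two other events; [r <= s] keeps the number of shifts of order [s^2]. *)
Lemma tau'_scale_bound (N : nat) : (3 <= N)%N ->
  exists S : R, forall (s : nat) (T V : 'I_L -> int -> Omega -> R) (r : R), (0 < s)%N ->
    S <= s%:R -> 1 <= r -> r <= s%:R -> s%:R ^+ 6 <= r ^+ N.+1 ->
    stationary_input P X0 V0 s T V ->
    (\int[P]_w `| tau' Pm C s T V w | <= (51 * r)%:E)%E.
Proof.
move=> N3; have [e e0 [eC eX]] := slack_exists.
pose zeta l := EV l / EX l + e.
(* The midpoint satisfies both strict inequalities needed: [mu < E X] for the slow event and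
   [E V / mu < zeta] for the crowd event. *)
pose mu l := (EV l / zeta l + EX l) / 2.
have zeta0 l : 0 < zeta l by rewrite /zeta ltr_wpDl// divr_ge0// ltW.
have EVX l : EV l / zeta l < EX l.
  rewrite ltr_pdivrMr// /zeta mulrDr mulrC divfK ?gt_eqF// ltrDl.
  by rewrite mulr_gt0.
have EVz l : 0 <= EV l / zeta l by rewrite divr_ge0// ltW.
have mu0 l : 0 < mu l by have := EX0 l; have := EVz l; rewrite /mu; lra.
have muX l : mu l < EX l by have := EVX l; rewrite /mu; lra.
have muV l : EV l / mu l < zeta l.
  have : EV l / zeta l < mu l by have := EVX l; rewrite /mu; lra.
  by rewrite !ltr_pdivrMr// mulrC.
have fE l : 'E_P[X0 l]%E \is a fin_num by rewrite unlock; exact: integrable_fin_num.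
have muXE l : ((mu l)%:E < 'E_P[X0 l])%E by rewrite -(fineK (fE l)) lte_fin.
have /choice[K1 K1P] := fun l =>
  ex2_conj _ _ (slow_le P (X0 l) (mX l) (Xge0 l) (mu l) (mu0 l) (muXE l)).
have /choice[K2 K2P] := fun l =>
  ex2_conj _ _ (long_le P (V0 l) (mV l) (iV l) (mu l) N (mu0 l)).
have /choice[K3 K3P] := fun l =>
  ex2_conj _ _ (crowd_le P (V0 l) (mV l) (Vpos l) (iV l) (mu l) (zeta l) (mu0 l) (muV l)).
have K10 l : 0 < K1 l by case: (K1P l).
have K20 l : 0 < K2 l by case: (K2P l).
have K30 l : 0 < K3 l by case: (K3P l).
(* A window fails with probability at most [G / s^2], and the far event of window [i] has at most
   [H / s^4 * 16^-i]; the threshold on [s] makes these at most [1/8] and [16^-i]. *)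
pose G := \sum_l ((mu l)^-1 + 2) * (K1 l / e ^+ 4 + K2 l + K3 l).
pose H := \sum_l (K1 l * mu l ^+ 4 + K2 l).
have G0 : 0 <= G.
  apply: sumr_ge0 => l _; have k1 := K10 l; have k2 := K20 l; have k3 := K30 l.
  have m1 : 0 < (mu l)^-1 by rewrite invr_gt0.
  have a1 : 0 < K1 l / e ^+ 4 by rewrite divr_gt0 ?exprn_gt0.
  by apply: mulr_ge0; lra.
have H0 : 0 <= H.
  apply: sumr_ge0 => l _; have k1 := K10 l; have k2 := K20 l.
  have a1 : 0 < K1 l * mu l ^+ 4 by rewrite mulr_gt0 ?exprn_gt0.
  lra.
have mus0 : 0 <= \sum_l mu l by apply: sumr_ge0 => l _; exact: ltW.
exists (1 + \sum_l mu l + 8 * G + H) => s T V r s0 Ss r1 rs rN inp.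
have sR0 : 0 < s%:R :> R by rewrite ltr0n.
have s1 : 1 <= s%:R :> R by rewrite ler1n.
have mus l : mu l <= s%:R.
  apply: le_trans Ss; rewrite (bigD1 l)//=.
  have : 0 <= \sum_(i | i != l) mu i by apply: sumr_ge0 => i _; exact: ltW.
  lra.
have Gs : 8 * G <= s%:R by lra.
have Hs : H <= s%:R by lra.
have r0 : 0 < r by lra.
pose c l := mu l / s%:R.
have c0 l : 0 < c l by rewrite divr_gt0.
pose n0 := Num.trunc (e * s%:R).
pose M l := (Num.trunc (r * s%:R / mu l)).+1.
pose n1 i l := Num.trunc (2 ^+ i * r * s%:R / mu l).
have pow0 i : 0 < 2 ^+ i :> R by rewrite exprn_gt0.
have B1 l n k := (K1P l).2 s _ _ _ _ _ s0 (input_measurable _ _ _ _ _ _ inp)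
  (input_indep _ _ _ _ _ _ inp) (gap_stream _ _ _ _ _ _ inp l) n k.
have B2 l w k := (K2P l).2 s _ _ _ _ _ s0 (mus l) (input_measurable _ _ _ _ _ _ inp)
  (service_stream _ _ _ _ _ _ inp l) w k.
have B3 l m k := (K3P l).2 s _ _ _ _ _ s0 (input_measurable _ _ _ _ _ _ inp)
  (input_indep _ _ _ _ _ _ inp) (service_stream _ _ _ _ _ _ inp l) m k.
have [mT mVs] : (forall l n, measurable_fun setT (T l n)) /\ (forall l n, measurable_fun setT (V l n)).
  by case: inp.
apply: (expected_tau'_le P X0 V0 s T V inp mX s0 Xpos _ Pm C c
  (fun l => s%:R * zeta l) M n1 n0 r r1) => //.
- by move=> l m; apply: (bounded_sum_null P _ T c mT l (K1 l)) => // n; exact: B1.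
- by move=> l; rewrite mulr_ge0// ltW.
- move=> l; rewrite /c mulrA ler_pdivlMr// -ler_pdivrMr//.
  exact/ltW/truncnS_gt.
- move=> l; apply: le_trans r1; apply: (@le_trans _ _ (e * s%:R * c l)).
    by rewrite ler_pM2r// truncn_le// ltW// mulr_gt0.
  rewrite (_ : e * s%:R * c l = e * mu l); last by rewrite /c; field; rewrite gt_eqF.
  by apply: le_trans (eX l); rewrite ler_pM2l// ltW.
- move=> i l; apply: (@le_trans _ _ (2 ^+ i * r * s%:R / mu l * c l)).
    rewrite ler_pM2r// /n1 truncn_le; apply/ltW; apply: divr_gt0 => //; apply: mulr_gt0 => //.
    by apply: mulr_gt0 => //; exact: pow0.
  by rewrite /c (_ : _ * (_ / _) = 2 ^+ i * r)//; field; rewrite !gt_eqF.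
- move=> j; rewrite natrM; apply: le_trans (ler_wpM2l (ltW sR0) (eC j)).
  rewrite mulr_sumr; apply: ler_sum => l _; rewrite [in leRHS]mulrDr /zeta lerD2r mulrC.
  by rewrite truncn_le// ltW// mulr_gt0.
- move=> a; apply: le_trans (window_bad_le P _ T V c _ M n0 r mT mVs
    (fun l => K1 l / n0.+1%:R ^+ 4) (fun l => K2 l * s%:R ^+ 2 / r ^+ N.+1)
    (fun l => K3 l / s%:R ^+ 4) a _ _ _) _.
  + by move=> l k; exact: B1.
  + by move=> l k; exact: B2.
  + by move=> l k; exact: B3.
  rewrite lee_fin; apply: (@le_trans _ _ (G / s%:R ^+ 2)); last first.
    rewrite ler_pdivrMr ?exprn_gt0//.
    have : s%:R <= s%:R ^+ 2 :> R by rewrite expr2 ler_peMl// ltW.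
    lra.
  rewrite /G mulr_suml; apply: ler_sum => l _.
  have k1 := K10 l; have k2 := K20 l; have k3 := K30 l.
  have h1 : K1 l / n0.+1%:R ^+ 4 <= K1 l / e ^+ 4 / s%:R ^+ 4.
    rewrite -mulrA ler_pM2l// -invfM -exprMn lef_pV2 ?posrE ?exprn_gt0 ?mulr_gt0//.
    rewrite lerXn2r ?nnegrE ?mulr_ge0 ?ltW//; exact: truncnS_gt.
  have h2 : K2 l * s%:R ^+ 2 / r ^+ N.+1 <= K2 l / s%:R ^+ 4.
    rewrite ler_pdivrMr ?exprn_gt0// mulrAC ler_pdivlMr ?exprn_gt0//.
    by rewrite -mulrA -exprD ler_pM2l.
  have h3 : (M l).+1%:R <= ((mu l)^-1 + 2) * s%:R ^+ 2.
    have : (Num.trunc (r * s%:R / mu l))%:R <= r * s%:R / mu l.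
      by rewrite truncn_le; apply/ltW; apply: divr_gt0 => //; exact: mulr_gt0.
    have : r * s%:R / mu l <= s%:R ^+ 2 / mu l.
      by rewrite ler_pM2r ?invr_gt0// expr2 ler_pM2r.
    have : 1 <= s%:R ^+ 2 :> R by rewrite exprn_ege1.
    rewrite /M -!natr1; set A := (Num.trunc _)%:R; set B := (mu l)^-1.
    set D := s%:R ^+ 2; lra.
  have q0 : 0 <= K1 l / n0.+1%:R ^+ 4 + K2 l * s%:R ^+ 2 / r ^+ N.+1 + K3 l / s%:R ^+ 4.
    have a1 : 0 < K1 l / n0.+1%:R ^+ 4 by rewrite divr_gt0 ?exprn_gt0.
    have a2 : 0 < K2 l * s%:R ^+ 2 / r ^+ N.+1 by rewrite divr_gt0 ?mulr_gt0 ?exprn_gt0.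
    have a3 : 0 < K3 l / s%:R ^+ 4 by rewrite divr_gt0 ?exprn_gt0.
    by apply: addr_ge0; [apply: addr_ge0|]; exact: ltW.
  apply: (@le_trans _ _ (((mu l)^-1 + 2) * s%:R ^+ 2 *
     ((K1 l / e ^+ 4 + K2 l + K3 l) / s%:R ^+ 4))).
    by apply: ler_pM => //; rewrite !mulrDl; apply: lerD => //; exact: lerD.
  rewrite le_eqVlt; apply/orP; left; apply/eqP; field.
  by rewrite !gt_eqF.
- move=> i b; apply: le_trans (far_bad_le P _ T V c mT mVs (n1 i) _
    (fun l => K1 l / (n1 i l).+1%:R ^+ 4)
    (fun l => K2 l * s%:R ^+ 2 / (2 ^+ i * r) ^+ N.+1) b _ _) _.
  + by move=> l k; exact: B1.
  + move=> l k; apply: B2; apply: le_trans r1 _; rewrite ler_peMl ?(ltW r0)//.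
    by rewrite exprn_ege1// ler1n.
  have p4 : (2 : R) ^+ i ^+ 4 = 16 ^+ i.
    by rewrite -exprM mulnC exprM; congr (_ ^+ _); ring.
  rewrite lee_fin; apply: (@le_trans _ _ (H / s%:R ^+ 4 * 16^-1 ^+ i)); last first.
    rewrite ler_piMl ?exprn_ge0 ?invr_ge0// ler_pdivrMr ?exprn_gt0// mul1r.
    by apply: le_trans Hs _; rewrite -[leLHS]expr1 ler_weXn2l.
  rewrite /H !mulr_suml; apply: ler_sum => l _.
  have k1 := K10 l; have k2 := K20 l.
  rewrite !mulrDl lerD//.
    have -> : K1 l * mu l ^+ 4 / s%:R ^+ 4 * 16^-1 ^+ i = K1 l / (2 ^+ i * s%:R / mu l) ^+ 4.
      by rewrite exprVn -p4; field; rewrite !gt_eqF.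
    have p0 : 0 < 2 ^+ i * s%:R / mu l by apply: divr_gt0 => //; exact: mulr_gt0.
    have pn : 2 ^+ i * s%:R / mu l <= (n1 i l).+1%:R.
      apply: le_trans (ltW (truncnS_gt _)).
      by rewrite ler_pM2r ?invr_gt0// ler_pM2r// ler_peMr// ltW.
    rewrite ler_pM2l// lef_pV2 ?posrE ?exprn_gt0//.
    by apply: lerXn2r => //; rewrite nnegrE ltW.
  have -> : K2 l / s%:R ^+ 4 * 16^-1 ^+ i = K2 l * s%:R ^+ 2 / (16 ^+ i * s%:R ^+ 6).
    by rewrite exprVn; field; rewrite !gt_eqF ?exprn_gt0.
  rewrite ler_pM2l ?mulr_gt0 ?exprn_gt0// lef_pV2 ?posrE ?mulr_gt0 ?exprn_gt0 ?mulr_gt0//.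
  rewrite exprMn; apply: ler_pM => //; rewrite ?exprn_ge0 ?(ltW sR0)//.
  (* [N >= 3] gives [(2^i)^(N+1) >= 16^i]. *)
  rewrite -p4 -!exprM; apply: ler_weXn2l; first by rewrite ler1n.
  by rewrite leq_mul2l ltnS N3 orbT.
Qed.

End asymptotics.

Theorem theorem2 (R : realType) (d : measure_display) (Omega : measurableType d)
  (P : probability Omega R) (J L : nat) (Pm : 'I_L -> 'I_J -> bool)
  (C : 'I_J -> nat) (X0 V0 : 'I_L -> Omega -> R)
  (T V : nat -> 'I_L -> int -> Omega -> R) :
  (* X_1^{(l)}: integrable, strictly positive, non-lattice *)
  (forall l, measurable_fun setT (X0 l)) ->
  (forall l, P.-integrable setT (fun w => (X0 l w)%:E)) ->
  (forall l, P [set w | 0 < X0 l w] = 1%E) ->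
  (forall l (h : R), 0 < h -> P [set w | exists k : int, X0 l w = k%:~R * h] != 1%E) ->
  (* V_1^{(l)}: nonnegative service time, all moments finite, continuous CDF *)
  (forall l, measurable_fun setT (V0 l)) ->
  (forall l, P [set w | 0 <= V0 l w] = 1%E) ->
  (forall l (q : R), 0 < q -> P.-integrable setT (fun w => (V0 l w `^ q)%:E)) ->
  (forall l (x : R), P [set w | V0 l w = x] = 0%E) ->
  (* traffic condition *)
  (forall j : 'I_J,
     \sum_(l < L | Pm l j) fine ('E_P[V0 l]) / fine ('E_P[X0 l]) < (C j)%:R) ->
  (* for each s >= 1, (T s, V s) is the stationary input of the s-th system *)
  (forall s : nat, (0 < s)%N -> stationary_input P X0 V0 s (T s) (V s)) ->
  (* E_pi^s |tau'| = o(s^delta) for every delta > 0 *)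
  forall delta : R, 0 < delta ->
  forall eps : R, 0 < eps ->
  exists N : nat, forall s : nat, (N <= s)%N ->
    (\int[P]_w `| tau' Pm C s (T s) (V s) w | <= (eps * (s%:R `^ delta))%:E)%E.
Proof.
move=> mX iX Xpos _ mV Vpos iV _ traffic inp delta delta0 eps eps0.
(* [a < delta] leaves a power of [s] to absorb constants, and [a <= 1/2] gives [r = s^a <= s]. *)
pose a : R := Num.min delta 1 / 2.
have m0 : 0 < Num.min delta 1 by rewrite lt_min delta0 ltr01.
have a0 : 0 < a by rewrite divr_gt0.
have a1 : a <= 2^-1 by rewrite /a ler_piMl ?invr_ge0// ge_min lexx orbT.
have ad : a < delta.
  have : Num.min delta 1 <= delta by rewrite ge_min lexx.
  by rewrite /a; lra.
(* Chosen so that [r^(N+1) = s^(a (N+1)) >= s^6]. *)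
pose N := Num.trunc (6 / a).
have NP : 6 <= a * N.+1%:R by rewrite mulrC -ler_pdivrMr//; exact/ltW/truncnS_gt.
have N3 : (3 <= N)%N.
  by rewrite -ltnS -(ltr_nat R); nra.
have [S SP] := tau'_scale_bound P Pm C X0 V0 mX iX Xpos mV Vpos iV traffic N N3.
(* For [s >= B] one has [51 <= eps * s^(delta - a)]. *)
pose B := (51 / eps) `^ (delta - a)^-1.
have da0 : 0 < delta - a by rewrite subr_gt0.
exists (Num.trunc (`|S| + B)).+1 => s Ns.
have s0 : (0 < s)%N by exact: leq_ltn_trans Ns.
have sR0 : 0 < s%:R :> R by rewrite ltr0n.
have s1 : 1 <= s%:R :> R by rewrite ler1n.
have SBs : `|S| + B <= s%:R.
  by apply: (le_trans (ltW (truncnS_gt _))); rewrite ler_nat.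
have B0 : 0 <= B by exact: powR_ge0.
have S1 := ler_norm S; have S2 := normr_ge0 S.
apply: (le_trans (SP s (T s) (V s) (s%:R `^ a) s0 _ _ _ _ (inp s s0))).
- by lra.
- by rewrite -[leLHS](powRr0 s%:R) ler_powR// ltW.
- by rewrite -[leRHS]powRr1 ?ler_powR ?(ltW sR0)//; lra.
- by rewrite -[leRHS]powR_mulrn ?powR_ge0// -powRrM -powR_mulrn ?(ltW sR0)// ler_powR.
have -> : s%:R `^ delta = s%:R `^ (delta - a) * s%:R `^ a.
  by rewrite -powRD ?subrK// (gt_eqF sR0) implybT.
rewrite lee_fin mulrA ler_pM2r ?powR_gt0// -ler_pdivrMl// mulrC.
have -> : 51 / eps = B `^ (delta - a).
  by rewrite /B -powRrM mulVf ?gt_eqF// powRr1// divr_ge0// ltW.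
apply: ge0_ler_powR; rewrite ?nnegrE ?(ltW da0) ?(ltW sR0)//; lra.
Qed.
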